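(* For each $n$, let $\{\eta_{n,v}: v\in V_n\}$ be a centered (mean zero) Gaussian field indexed by a finite nonempty set $V_n$, and for $S\subseteq V_n$ put $g_n(S)=\mathbb{E}[\sup_{v\in S}\eta_{n,v}]$ and $\sigma_n^2=\sup_{v\in V_n}\mathbb{E}[\eta_{n,v}^2]$. Assume the sequence is non-degenerate, i.e. $$\lim_{n\to\infty}\frac{g_n(V_n)}{\sigma_n}=\infty.$$ Fix $0<\alpha<1$ and define the (random) level set $$U_{n,\alpha}=\{v\in V_n:\ \eta_{n,v}\ge \alpha\, g_n(V_n)\}.$$ Then $$\frac{g_n(U_{n,\alpha})}{g_n(V_n)}\longrightarrow \sqrt{1-\alpha^2}\quad\text{in probability as } n\to\infty.$$
   Context: $g_n$ is a deterministic set function determined by the law of the field; $g_n(U_{n,\alpha})$ denotes the random variable obtained by evaluating $g_n$ at the random set $U_{n,\alpha}$ (i.e. $g_n(U_{n,\alpha})=\mathbb{E}[\sup_{v\in S}\eta_{n,v}]$ evaluated at $S=U_{n,\alpha}$, the expectation being with respect to the law of the field, not conditional on $U_{n,\alpha}$). Convention: $g_n(\emptyset)=-\infty$. *)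

(* Defs.v *)
From HB Require Import structures.
From mathcomp Require Import all_boot all_order all_algebra.
From mathcomp Require Import all_classical all_reals all_analysis.
Set Implicit Arguments. Unset Strict Implicit. Unset Printing Implicit Defensive.
Import Order.TTheory GRing.Theory Num.Theory.
Local Open Scope classical_set_scope.
Local Open Scope ring_scope.

(* A real random variable Y on (T,P) is centered Gaussian if it is measurable
   and its law is N(0, s^2) for some s >= 0, where N(0,0) is the Dirac mass
   at 0 (degenerate Gaussian). *)
Definition centered_gaussian_rv {R : realType} d (T : measurableType d)
  (P : probability T R) (Y : T -> R) : Prop :=
  measurable_fun setT Y /\
  exists s : R, 0 <= s /\
    forall B : set R, measurable B ->
      P (Y @^-1` B) = (if s == 0 then \d_(0:R) B else normal_prob 0 s B).

Definition centered_gaussian_field {R : realType} d (T : measurableType d)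
  (P : probability T R) (V : finType) (eta : V -> T -> R) : Prop :=
  forall a : V -> R, centered_gaussian_rv P (fun w => \sum_(v : V) a v * eta v w).

Definition field_sup {R : realType} (T : Type) (V : finType)
  (eta : V -> T -> R) (S : {set V}) (w : T) : \bar R :=
  \big[maxe/-oo%E]_(v in S) (eta v w)%:E.

Definition gfun {R : realType} d (T : measurableType d) (P : probability T R)
  (V : finType) (eta : V -> T -> R) (S : {set V}) : \bar R :=
  if S == finset.set0 then -oo%E else (\int[P]_w field_sup eta S w)%E.

Definition field_sigma {R : realType} d (T : measurableType d)
  (P : probability T R) (V : finType) (eta : V -> T -> R) : R :=
  Num.sqrt (fine (\big[maxe/-oo%E]_(v : V) ('E_P[fun w => (eta v w ^+ 2)%R])%E)).

Definition level_set {R : realType} d (T : measurableType d)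
  (P : probability T R) (V : finType) (eta : V -> T -> R) (alpha : R) (w : T)
  : {set V} :=
  [set v | alpha * fine (gfun P eta [set: V]) <= eta v w].

(* Main.v *)
Require Import Defs.
From HB Require Import structures.
From mathcomp Require Import all_boot all_order all_algebra.
From mathcomp Require Import all_classical all_reals all_analysis.
From mathcomp Require Import measurable_realfun ring lra.
Import Order.TTheory GRing.Theory Num.Theory.
Import numFieldNormedType.Exports.
Set Implicit Arguments. Unset Strict Implicit. Unset Printing Implicit Defensive.
Local Open Scope classical_set_scope.
Local Open Scope ring_scope.

(* Let [eta'] be an independent copy of [eta]; for [a^2 + b^2 = 1] the pair
   [(a eta + b eta', b eta - a eta')] has the law of [(eta, eta')].

   Concentration: [E |max_S eta - g(S)| <= (pi + 1) sigma].  Going from [eta] to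
   [eta'] along the rotations by multiples of [delta = pi / (2 N)], each step has
   the law of [max eta - max (cos delta eta + sin delta eta')], whose positive part
   is at most [(1 - cos delta) |max eta| + sin delta |eta'_v|] with [v] the
   maximizer of [eta], which is independent of [eta'].

   Upper bound: for [b = sqrt (1 - alpha^2)] and [U = U_alpha],
   [max (alpha eta + b eta') >= alpha^2 g + b max_U eta'], so averaging over
   [eta'], [g(U) >= (b + eps) g] forces the mean of
   [(max (alpha eta + b eta') - g)_+] to be at least [b eps g], whereas it is
   [O(sigma)].

   Lower bound: for [a] slightly above [alpha] and [b' = sqrt (1 - a^2)], rotating
   the pair shows that some [v] has [eta_v] close to [a g] and [eta'_v] close to
   [b' g], up to [O(sigma)] in mean; such a [v] lies in [U], hence
   [max_U eta' >= b' g - O(sigma)], and concentration replaces [max_U eta'] by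
   [g(U)].

   Rotation invariance is proved without characteristic functions in several
   variables: linear combinations have the same one-dimensional law, which settles
   expectations of trigonometric polynomials, hence of their uniform limits; this
   algebra is a lattice and thus contains all the functions built from maxima. *)

(** * Centered normal laws on the line *)

Section normal.
Context {R : realType}.
Local Notation mu := (@lebesgue_measure R).

(** The Radon-Nikodym derivative of the normal law and [normal_pdf] have the same integral over
    every measurable set, hence agree almost everywhere. *)
Lemma ge0_integral_normal_prob (s : R) (f : R -> \bar R) :
  measurable_fun setT f -> (forall x, 0 <= f x)%E ->
  (\int[normal_prob 0%R s]_x f x = \int[mu]_x (f x * (normal_pdf 0 s x)%:E))%E.
Proof.
move=> mf f0; have dom := normal_prob_dominates 0 s.
rewrite -(Radon_Nikodym_SigmaFinite.change_of_variables dom)//.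
have mpdf : measurable_fun setT (EFin \o normal_pdf 0 s).
  by apply/measurable_EFinP; exact: measurable_normal_pdf.
have ird := Radon_Nikodym_SigmaFinite.f_integrable dom.
apply: ae_eq_integral => //.
- by apply: emeasurable_funM => //; exact: (measurable_int mu).
- exact: emeasurable_funM.
- apply: ae_eqe_mul2l => /=; apply: integral_ae_eq => //= E _ mE.
  by rewrite -Radon_Nikodym_SigmaFinite.f_integral.
Qed.

(** Mean of [f] under N(0, s^2); the case [s == 0] is the Dirac mass, matching the case split in
    [centered_gaussian_rv]. *)
Definition gaussint (s : R) (f : R -> \bar R) : \bar R :=
  if s == 0 then f 0 else (\int[mu]_x (f x * (normal_pdf 0 s x)%:E))%E.

Lemma gaussint0 f : gaussint 0 f = f 0.
Proof. by rewrite /gaussint eqxx. Qed.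

Lemma gaussintE s f : 0 < s ->
  gaussint s f = (\int[mu]_x (f x * (normal_pdf 0 s x)%:E))%E.
Proof. by move=> s0; rewrite /gaussint (gt_eqF s0). Qed.

Lemma gaussint_ge0 s f : (forall x, 0 <= f x)%E -> (0 <= gaussint s f)%E.
Proof.
move=> f0; rewrite /gaussint; case: ifP => // _; apply: integral_ge0 => x _.
by rewrite mule_ge0// lee_fin normal_pdf_ge0.
Qed.

Lemma ge0_integral_translation (G : R -> R) (c : R) :
  continuous G -> (forall x, 0 <= G x) ->
  (\int[mu]_x (G x)%:E = \int[mu]_x (G (x + c))%:E)%E.
Proof.
move=> cG G0; pose F (x : R) : R := x + c.
have F'E : F^`()%classic = cst 1.
  apply/funext => x; rewrite /F derive1E deriveD// derive_cst derive_id.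
  by rewrite addr0.
rewrite (@increasing_ge0_integration_by_substitutionT R F G)//.
- by apply: eq_integral => x _; rewrite !fctE/= F'E mulr1.
- by move=> x y xy; rewrite /F ltrD2r.
- by rewrite F'E => ?; exact: cvg_cst.
- by rewrite F'E; exact: is_cvg_cst.
- by rewrite F'E; exact: is_cvg_cst.
- exact: cvg_addrr_Ny.
- exact: cvg_addrr.
Qed.

Lemma ge0_integral_scaling (G : R -> R) (c : R) :
  0 < c -> continuous G -> (forall x, 0 <= G x) ->
  (\int[mu]_x (G x)%:E = \int[mu]_x (G (x * c) * c)%:E)%E.
Proof.
move=> c0 cG G0; pose F (x : R) : R := x * c.
have F'E : F^`()%classic = cst c.
  apply/funext => x; rewrite /F derive1E deriveM// derive_cst derive_id.
  by rewrite scaler0 add0r; exact: mulr1.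
rewrite (@increasing_ge0_integration_by_substitutionT R F G)//.
- by apply: eq_integral => x _; rewrite !fctE/= F'E.
- by move=> x y xy; rewrite /F ltr_pM2r.
- by rewrite F'E => ?; exact: cvg_cst.
- by rewrite F'E; exact: is_cvg_cst.
- by rewrite F'E; exact: is_cvg_cst.
- exact: gt0_cvgMlNy.
- exact: gt0_cvgMly.
Qed.

Lemma normal_pdf_scale (s x : R) : 0 < s ->
  normal_pdf 0 s (x * s) * s = normal_pdf 0 1 x.
Proof.
move=> s0; rewrite !normal_pdfE ?gt_eqF//= /normal_peak /normal_fun.
rewrite !subr0 expr1n mul1r.
have -> : (- (x * s) ^+ 2 / (s ^+ 2 *+ 2)) = - x ^+ 2 / (1 *+ 2).
  by field; rewrite gt_eqF.
rewrite -mulrnAr sqrtrM ?sqr_ge0// sqrtr_sqr gtr0_norm// invfM.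
set r := (Num.sqrt _)^-1; set e := expR _.
by rewrite mulrC -!mulrA mulVKf// gt_eqF.
Qed.

(** The substitution [x = s y] isolates the second moment at [s = 1], which is never evaluated:
    later arguments use only that it is positive and finite. *)
Lemma gaussint_sqr (s : R) : 0 <= s ->
  gaussint s (fun x => (x ^+ 2)%:E) =
  ((s ^+ 2)%:E * gaussint 1 (fun x => (x ^+ 2)%:E))%E.
Proof.
rewrite le_eqVlt => /predU1P[<-|s0].
  by rewrite gaussint0 !expr0n/= mul0e.
rewrite (gaussintE _ s0) (gaussintE _ ltr01).
have cG : continuous (fun x : R => x ^+ 2 * normal_pdf 0 s x).
  move=> x; apply: cvgM; first exact: exprn_continuous.
  by apply: continuous_normal_pdf; rewrite gt_eqF.
rewrite [LHS](_ : _ = \int[mu]_x (x ^+ 2 * normal_pdf 0 s x)%:E)%E//.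
rewrite (ge0_integral_scaling s0 cG); last first.
  by move=> x; rewrite mulr_ge0 ?sqr_ge0 ?normal_pdf_ge0.
rewrite -ge0_integralZl_EFin//; last 3 first.
- by move=> x _; rewrite mule_ge0 ?lee_fin ?sqr_ge0 ?normal_pdf_ge0.
- apply: emeasurable_funM; apply/measurable_EFinP; last exact: measurable_normal_pdf.
  exact: measurable_funX.
- exact: sqr_ge0.
apply: eq_integral => x _; rewrite -!EFinM; congr EFin.
by rewrite -mulrA normal_pdf_scale// exprMn; ring.
Qed.

(** Completing the square in [x]: the joint density of a summand and the sum [z] is the density of
    the sum times the conditional density of the summand given [z]. *)
Lemma normal_pdf_conv (s1 s2 x z : R) : 0 < s1 -> 0 < s2 ->
  let s := Num.sqrt (s1 ^+ 2 + s2 ^+ 2) in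
  normal_pdf 0 s2 (z - x) * normal_pdf 0 s1 x =
  normal_pdf 0 s z * normal_pdf (z * (s1 ^+ 2 / s ^+ 2)) (s1 * s2 / s) x.
Proof.
move=> s10 s20 s.
have ss : s ^+ 2 = s1 ^+ 2 + s2 ^+ 2.
  by rewrite sqr_sqrtr// addr_ge0 ?sqr_ge0.
have s0 : 0 < s by rewrite sqrtr_gt0 addr_gt0 ?exprn_gt0.
have t0 : 0 < s1 * s2 / s by rewrite divr_gt0 ?mulr_gt0.
rewrite !normal_pdfE ?gt_eqF//= /normal_peak /normal_fun.
rewrite mulrACA [RHS]mulrACA -!expRD -!invfM -!sqrtrM; last 2 first.
- by rewrite mulrn_wge0// mulr_ge0 ?sqr_ge0 ?pi_ge0.
- by rewrite mulrn_wge0// mulr_ge0 ?sqr_ge0 ?pi_ge0.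
have s1n : s1 != 0 by rewrite gt_eqF.
have s2n : s2 != 0 by rewrite gt_eqF.
have sn : s != 0 by rewrite gt_eqF.
have ssn : s1 ^+ 2 + s2 ^+ 2 != 0 by rewrite -ss expf_neq0.
have pn : s ^+ 2 != 0 by rewrite expf_neq0.
congr ((Num.sqrt _)^-1 * expR _).
- by field.
- by rewrite !exprMn exprVn ss; field; rewrite s1n s2n ssn.
Qed.

(** After translating the inner variable and exchanging integrals by Tonelli, [normal_pdf_conv]
    leaves a normal density in [x], which integrates to 1. *)
Lemma ge0_gaussint_conv (h : R -> R) (s1 s2 : R) :
  continuous h -> (forall x, 0 <= h x) -> 0 <= s1 -> 0 <= s2 ->
  gaussint s1 (fun x => gaussint s2 (fun y => (h (x + y))%:E)) =
  gaussint (Num.sqrt (s1 ^+ 2 + s2 ^+ 2)) (fun x => (h x)%:E).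
Proof.
move=> ch h0; rewrite le_eqVlt => /predU1P[<-|s10].
  move=> s20; rewrite expr0n add0r sqrtr_sqr (ger0_norm s20) gaussint0.
  by congr gaussint; apply/funext => x; rewrite add0r.
rewrite le_eqVlt => /predU1P[<-|s20].
  rewrite expr0n addr0 sqrtr_sqr gtr0_norm//; congr gaussint.
  by apply/funext => x; rewrite gaussint0 addr0.
set s := Num.sqrt _.
have s0 : 0 < s by rewrite sqrtr_gt0 addr_gt0 ?exprn_gt0.
rewrite (gaussintE _ s10) (gaussintE _ s0).
pose F (z : R * R) : \bar R :=
  (h z.2 * normal_pdf 0 s2 (z.2 - z.1) * normal_pdf 0 s1 z.1)%:E.
have mh : measurable_fun setT h by exact: continuous_measurable_fun.
have mF : measurable_fun setT F.
  apply/measurable_EFinP; apply: measurable_funM; last first.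
    by apply: measurableT_comp => //; exact: measurable_normal_pdf.
  apply: measurable_funM; first exact: measurableT_comp.
  apply: measurableT_comp; first exact: measurable_normal_pdf.
  exact: measurable_funB.
have F0 z : (0 <= F z)%E by rewrite lee_fin !mulr_ge0 ?normal_pdf_ge0.
transitivity (\int[mu]_x \int[mu]_z F (x, z))%E.
  apply: eq_integral => x _; rewrite (gaussintE _ s20).
  rewrite [X in (X * _)%E](_ : _ = \int[mu]_y (h (x + y) * normal_pdf 0 s2 y)%:E)%E//.
  rewrite (@ge0_integral_translation _ (- x)); last 2 first.
  - move=> y; apply: cvgM; last first.
      by apply: continuous_normal_pdf; rewrite gt_eqF.
    apply: continuous_comp; last exact: ch.
    by apply: cvgD; [exact: cvg_cst|exact: cvg_id].
  - by move=> y; rewrite mulr_ge0 ?normal_pdf_ge0.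
  rewrite -ge0_integralZr//.
  - by apply: eq_integral => y _; rewrite /F/= addrCA subrr addr0 -EFinM.
  - apply/measurable_EFinP; apply: measurable_funM.
      by apply: measurableT_comp => //; do 2 apply: measurable_funD => //.
    by apply: measurableT_comp; [exact: measurable_normal_pdf|exact: measurable_funD].
  - by move=> y _; rewrite lee_fin mulr_ge0 ?normal_pdf_ge0.
  - by rewrite lee_fin normal_pdf_ge0.
transitivity (\int[mu]_z \int[mu]_x F (x, z))%E.
  exact: (@fubini_tonelli _ _ _ _ _ mu mu F).
apply: eq_integral => z _.
rewrite [LHS](_ : _ = \int[mu]_x ((h z * normal_pdf 0 s z)%:E *
   (normal_pdf (z * (s1 ^+ 2 / s ^+ 2)) (s1 * s2 / s) x)%:E))%E; last first.
  apply: eq_integral => x _; rewrite /F/= -EFinM; congr (_%:E).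
  by rewrite -[LHS]mulrA -[RHS]mulrA; congr (_ * _); exact: normal_pdf_conv.
rewrite ge0_integralZl//.
- by rewrite integral_normal_pdf mule1 EFinM.
- by apply/measurable_EFinP; exact: measurable_normal_pdf.
- by move=> x _; rewrite lee_fin normal_pdf_ge0.
- by rewrite lee_fin mulr_ge0 ?normal_pdf_ge0.
Qed.

End normal.

(** * Linear combinations of two independent copies *)

Section gaussian_rv.
Context {R : realType} d (T : measurableType d) (P : probability T R).

Lemma centered_gaussian_rv_integral (Y : T -> R) : centered_gaussian_rv P Y ->
  exists2 s : R, 0 <= s & forall f : R -> \bar R,
    measurable_fun setT f -> (forall x, 0 <= f x)%E ->
    (\int[P]_w f (Y w) = gaussint s f)%E.
Proof.
move=> [mY [s [s0 PY]]]; exists s => // f mf f0.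
pose Y' : T -> measurableTypeR R := Y.
have mY' : measurable_fun setT Y' by exact: mY.
have push : (\int[pushforward P Y']_x f x = \int[P]_w f (Y w))%E.
  by rewrite ge0_integral_pushforward.
rewrite -push /gaussint; move: PY; case: ifP => [_|_] PY.
  rewrite (eq_measure_integral (\d_ (0 : measurableTypeR R)))/=; last first.
    by move=> B mB _; exact: PY.
  by rewrite integral_dirac// diracT mul1e.
rewrite -ge0_integral_normal_prob//.
by apply: eq_measure_integral => B mB _; exact: PY.
Qed.

(** Independence is the product measure: integrating the second coordinate first produces the
    iterated [gaussint] of [ge0_gaussint_conv]. *)
Lemma ge0_integral_gaussian_sum (A B : T -> R) (s1 s2 : R) (h : R -> R) :
  measurable_fun setT A -> measurable_fun setT B ->
  0 <= s1 -> 0 <= s2 ->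
  (forall f : R -> \bar R, measurable_fun setT f -> (forall x, 0 <= f x)%E ->
    (\int[P]_w f (A w) = gaussint s1 f)%E) ->
  (forall f : R -> \bar R, measurable_fun setT f -> (forall x, 0 <= f x)%E ->
    (\int[P]_w f (B w) = gaussint s2 f)%E) ->
  continuous h -> (forall x, 0 <= h x) ->
  (\int[P \x P]_z (h (A z.1 + B z.2))%:E =
   gaussint (Num.sqrt (s1 ^+ 2 + s2 ^+ 2)) (fun x => (h x)%:E))%E.
Proof.
move=> mA mB s10 s20 lA lB ch h0.
have mh : measurable_fun setT h by exact: continuous_measurable_fun.
have mF : measurable_fun setT (fun z : T * T => (h (A z.1 + B z.2))%:E).
  apply/measurable_EFinP; apply: measurableT_comp => //.
  by apply: measurable_funD; exact: measurableT_comp.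
rewrite fubini_tonelli1//; last by move=> z; rewrite lee_fin.
rewrite -ge0_gaussint_conv//.
have inner x : (\int[P]_y (h (x + B y))%:E)%E = gaussint s2 (fun y => (h (x + y))%:E).
  apply: (lB (fun y => (h (x + y))%:E)) => [|y]; last by rewrite lee_fin.
  by apply/measurable_EFinP; apply: measurableT_comp => //; exact: measurable_funD.
rewrite -lA.
- by apply: eq_integral => x _; rewrite -inner.
- have mG : measurable_fun setT (fun z : R * T => (h (z.1 + B z.2))%:E).
    apply/measurable_EFinP; apply: measurableT_comp => //.
    by apply: measurable_funD => //; exact: measurableT_comp.
  have := @measurable_fun_fubini_tonelli_F _ _ _ _ R P _ mG.
  rewrite (_ : fubini_F _ _ = fun x : R => gaussint s2 (fun y => (h (x + y))%:E)).
    by apply => z; rewrite lee_fin.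
  by apply/funext => x; rewrite -inner.
- by move=> x; apply: gaussint_ge0 => y; rewrite lee_fin.
Qed.

End gaussian_rv.

(** The map [pr] lets several indices share one point of the field, with different coefficients;
    thus several mixtures of the same two copies are treated jointly. *)
Definition pairfield {R : realType} {T : Type} {V W : finType}
    (eta : V -> T -> R) (pr : W -> V) (a b : W -> R) (w : W) (z : T * T) : R :=
  a w * eta (pr w) z.1 + b w * eta (pr w) z.2.

Section pairfield.
Context {R : realType} d (T : measurableType d) (P : probability T R).
Context (V W : finType) (eta : V -> T -> R) (pr : W -> V).
Hypothesis gauss_eta : centered_gaussian_field P eta.

Lemma centered_gaussian_field_pull (c : W -> R) :
  centered_gaussian_rv P (fun w => \sum_(i : W) c i * eta (pr i) w).
Proof.
have := gauss_eta (fun v => \sum_(i | pr i == v) c i).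
congr centered_gaussian_rv; apply/funext => w.
rewrite [RHS](partition_big pr xpredT)//=; apply: eq_bigr => v _.
by rewrite mulr_suml; apply: eq_bigr => i /eqP ->.
Qed.

Let k2 : \bar R := gaussint 1 (fun x => (x ^+ 2)%:E).
Hypotheses (k2_gt0 : (0 < k2)%E) (k2_lty : (k2 < +oo)%E).

(* The squares of the two components of a linear combination add up, pointwise,
   to the same quadratic form: this is how the Gram matrix of the coefficients
   alone determines the variance. *)
Lemma pairfield_lincomb_integral (a b a' b' c : W -> R) (h : R -> R) :
  (forall u v, a u * a v + b u * b v = a' u * a' v + b' u * b' v) ->
  continuous h -> (forall x, 0 <= h x) ->
  (\int[P \x P]_z (h (\sum_w c w * pairfield eta pr a b w z))%:E =
   \int[P \x P]_z (h (\sum_w c w * pairfield eta pr a' b' w z))%:E)%E.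
Proof.
move=> gram ch h0.
pose L (a0 : W -> R) (x : T) := \sum_w (c w * a0 w) * eta (pr w) x.
have sumE a1 b1 z :
    \sum_w c w * pairfield eta pr a1 b1 w z = L a1 z.1 + L b1 z.2.
  rewrite /L -big_split/=; apply: eq_bigr => w _.
  by rewrite /pairfield mulrDr !mulrA.
have gL a0 : centered_gaussian_rv P (L a0) by exact: centered_gaussian_field_pull.
have mL a0 : measurable_fun setT (L a0) by case: (gL a0).
have sqrE a1 b1 x : L a1 x ^+ 2 + L b1 x ^+ 2 =
    \sum_u \sum_v (c u * c v * eta (pr u) x * eta (pr v) x) * (a1 u * a1 v + b1 u * b1 v).
  rewrite !expr2 !mulr_suml -big_split/=; apply: eq_bigr => u _.
  rewrite !mulr_sumr -big_split/=; apply: eq_bigr => v _; ring.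
have [s1 s10 l1] := centered_gaussian_rv_integral (gL a).
have [s2 s20 l2] := centered_gaussian_rv_integral (gL b).
have [s3 s30 l3] := centered_gaussian_rv_integral (gL a').
have [s4 s40 l4] := centered_gaussian_rv_integral (gL b').
have msqr : measurable_fun setT (fun x : R => (x ^+ 2)%:E).
  by apply/measurable_EFinP; exact: measurable_funX.
have sqr0 (x : R) : (0 <= (x ^+ 2)%:E)%E by rewrite lee_fin sqr_ge0.
have mom (f g : T -> R) s t : 0 <= s -> 0 <= t ->
    measurable_fun setT f -> measurable_fun setT g ->
    (forall h : R -> \bar R, measurable_fun setT h -> (forall x, 0 <= h x)%E ->
      (\int[P]_w h (f w) = gaussint s h)%E) ->
    (forall h : R -> \bar R, measurable_fun setT h -> (forall x, 0 <= h x)%E ->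
      (\int[P]_w h (g w) = gaussint t h)%E) ->
    (\int[P]_x (f x ^+ 2 + g x ^+ 2)%:E = (s ^+ 2 + t ^+ 2)%:E * k2)%E.
  move=> s0 t0 mf mg lf lg.
  under eq_integral do rewrite EFinD.
  rewrite ge0_integralD//; last 2 first.
  - by apply/measurable_EFinP; exact: measurable_funX.
  - by apply/measurable_EFinP; exact: measurable_funX.
  rewrite (lf (fun x => (x ^+ 2)%:E))// (lg (fun x => (x ^+ 2)%:E))//.
  by rewrite (gaussint_sqr s0) (gaussint_sqr t0) EFinD (ge0_muleDl _ (sqr0 s) (sqr0 t)).
(* Both sides times [k2] are integrals over [T] of pointwise equal quadratic forms; [k2] is finite
   and nonzero, so it cancels. *)
have seq : s1 ^+ 2 + s2 ^+ 2 = s3 ^+ 2 + s4 ^+ 2.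
  have k2fin : k2 \is a fin_num by rewrite ge0_fin_numE// ltW.
  have : ((s1 ^+ 2 + s2 ^+ 2)%:E * k2 = (s3 ^+ 2 + s4 ^+ 2)%:E * k2)%E.
    rewrite -(mom _ _ _ _ s10 s20 _ _ l1 l2)// -(mom _ _ _ _ s30 s40 _ _ l3 l4)//.
    apply: eq_integral => x _; rewrite !sqrE; congr (_%:E).
    by apply: eq_bigr => u _; apply: eq_bigr => v _; rewrite gram.
  rewrite -(fineK k2fin) -!EFinM => -[] /mulIf; apply.
  by rewrite fine_eq0// gt_eqF.
under eq_integral do rewrite sumE.
under [RHS]eq_integral do rewrite sumE.
have -> := ge0_integral_gaussian_sum (mL a) (mL b) s10 s20 l1 l2 ch h0.
have -> := ge0_integral_gaussian_sum (mL a') (mL b') s30 s40 l3 l4 ch h0.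
by rewrite seq.
Qed.

End pairfield.

(** * Trigonometric approximation *)

Section trigo_bounds.
Context {R : realType}.
Implicit Types x : R.

Lemma sin_mean_value x : exists2 c, `|c| <= `|x| & sin x = cos c * x.
Proof.
wlog x0 : x / 0 <= x => [hw|].
  have [|x0] := leP 0 x; first exact: hw.
  have [|c cx sx] := hw (- x); first by rewrite oppr_ge0 ltW.
  exists c; first by rewrite normrN in cx.
  by move: sx; rewrite sinN mulrN => /oppr_inj.
move: x0; rewrite le_eqVlt => /predU1P[<-|x0].
  by exists 0; rewrite ?sin0 ?mulr0.
have [c cx] := @MVT R (@sin R) (@cos R) 0 x x0 (fun y _ => is_derive_sin y)
  (continuous_subspaceT (@continuous_sin R)).
rewrite sin0 !subr0 => ->; exists c => //.
by move: cx; rewrite in_itv/= => /andP[c0 cx]; rewrite !gtr0_norm// ltW.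
Qed.

Lemma norm_sin_le x : `|sin x| <= `|x|.
Proof.
have [c _ ->] := sin_mean_value x.
by rewrite normrM ler_piMl// cos_max.
Qed.

Lemma onem_cos_le x : 1 - cos x <= x ^+ 2 / 2.
Proof.
have -> : cos x = 1 - 2 * sin (x / 2) ^+ 2.
  have {1}-> : x = (x / 2) *+ 2 by rewrite -mulr_natr divfK.
  by rewrite cos_mulr2n cos2sin2 -[_ *+ 2]mulr_natl; ring.
have : `|sin (x / 2)| ^+ 2 <= `|x / 2| ^+ 2.
  by rewrite lerXn2r ?nnegrE// norm_sin_le.
rewrite !real_normK ?num_real//; lra.
Qed.

Lemma norm_sin_div_le (t L : R) : 0 < L -> `|L * sin (t / L)| <= `|t|.
Proof.
move=> L0; rewrite normrM (gtr0_norm L0) -[leRHS](@divfK _ L) ?gt_eqF//.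
rewrite [leRHS]mulrC (ler_wpM2l (ltW L0))// (le_trans (norm_sin_le _))//.
by rewrite normrM normfV (gtr0_norm L0).
Qed.

(** The mean value point satisfies [|c| <= |t| / L], so the error [|t| (1 - cos c)] is at most
    [|t| c^2]; [L >= 1] then weakens [L^-2] to [L^-1]. *)
Lemma sin_div_dist_le (t L : R) : 1 <= L ->
  `|L * sin (t / L) - t| <= `|t| ^+ 3 / L.
Proof.
move=> L1; have L0 : 0 < L by exact: lt_le_trans L1.
have [c cx ->] := sin_mean_value (t / L).
have -> : L * (cos c * (t / L)) - t = - (t * (1 - cos c)).
  by field; rewrite gt_eqF.
have c1 : 0 <= 1 - cos c by rewrite subr_ge0 cos_le1.
rewrite normrN normrM (ger0_norm c1) (exprS `|t| 2) -mulrA ler_wpM2l//.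
apply: (le_trans (onem_cos_le c)).
have : `|c| ^+ 2 <= (`|t| / L) ^+ 2.
  rewrite lerXn2r ?nnegrE//; first by rewrite divr_ge0// ltW.
  by rewrite (le_trans cx)// normrM normfV (gtr0_norm L0).
rewrite real_normK ?num_real// => /le_trans h.
apply: (@le_trans _ _ (c ^+ 2)); first by have := sqr_ge0 c; lra.
apply: h; rewrite exprMn ler_wpM2l ?sqr_ge0// exprVn expr2.
by rewrite lef_pV2 ?posrE ?mulr_gt0// ler_peMl// ltW.
Qed.

End trigo_bounds.

(** * Polynomial approximation of the absolute value on [-1, 1] *)

Section abs_approximation.
Context {R : realType}.

(** The classical iteration for the square root of [x^2] used in proofs of the Stone-Weierstrass
    theorem. *)
Fixpoint abs_poly (k : nat) (x : R) : R :=
  if k is k'.+1 then abs_poly k' x + (x ^+ 2 - abs_poly k' x ^+ 2) / 2 else 0.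

(** With [e = |x| - p], the next error is [e (1 - (|x| + p) / 2) <= e (1 - e / 2)]. Since
    [t (1 - t / 2)] increases on [0, 1], the bound [2 / (k + 2)] passes to [2 / (k + 3)]. *)
Lemma abs_poly_bound (k : nat) (x : R) : `|x| <= 1 ->
  0 <= abs_poly k x <= `|x| /\ `|x| - abs_poly k x <= 2 / k.+2%:R.
Proof.
move=> x1; elim: k => [|k [/andP[p0 px] IH]] /=.
  by rewrite lexx normr_ge0 subr0 divff// pnatr_eq0.
rewrite -(real_normK (num_real x)); move: px IH x1 (normr_ge0 x).
move: `|x| (abs_poly k x) p0 => {}x p p0 px IH x1 x0.
split; first by apply/andP; split; nra.
set a := 2 / k.+2%:R in IH.
have k2 : 0 < k.+2%:R :> R by rewrite ltr0n.
have a1 : 0 <= a <= 1.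
  apply/andP; split; first by rewrite divr_ge0// ltW.
  by rewrite ler_pdivrMr// mul1r ler_nat.
set e := x - p in IH.
apply: (@le_trans _ _ (e * (1 - e / 2))); first by rewrite /e; nra.
apply: (@le_trans _ _ (a * (1 - a / 2))); first by rewrite /e in IH *; nra.
have -> : k.+3%:R = k.+2%:R + 1 :> R by rewrite -addn1 natrD.
rewrite /a ler_pdivlMr ?addr_gt0//.
have -> : 2 / k.+2%:R * (1 - 2 / k.+2%:R / 2) * (k.+2%:R + 1) =
          2 - 2 / k.+2%:R ^+ 2 :> R by field; rewrite gt_eqF.
by rewrite gerBl divr_ge0// ?exprn_ge0 ?ltW.
Qed.

End abs_approximation.

(** * Trigonometric polynomials and their uniform closure *)

Section trigonometric_approximation.
Context {R : realType} (W : finType).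
Implicit Types (f g p q : (W -> R) -> R) (x : W -> R).

(** Frequencies are arbitrary reals, and the phase [phi] makes sines a special case of the single
    generator. *)
Inductive trigpoly : ((W -> R) -> R) -> Prop :=
| trigpoly_cos k (c : W -> R) (phi : R) :
    trigpoly (fun x => k * cos (\sum_w c w * x w + phi))
| trigpolyD f g : trigpoly f -> trigpoly g -> trigpoly (fun x => f x + g x).

(** By bilinearity it suffices to multiply two cosines, where the product-to-sum formula applies. *)
Lemma trigpolyM f g : trigpoly f -> trigpoly g -> trigpoly (fun x => f x * g x).
Proof.
elim=> [k c phi|{}f f' _ IHf _ IHf'] tg; last first.
  rewrite (_ : (fun _ => _) = fun x => f x * g x + f' x * g x).
    by apply: trigpolyD; [exact: IHf|exact: IHf'].
  by apply/funext => x; rewrite mulrDl.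
elim: tg => [k' c' phi'|{}g g' _ IHg _ IHg']; last first.
  set h := fun x => _ in IHg; set h' := fun x => _ in IHg'.
  rewrite (_ : (fun _ => _) = fun x => h x + h' x); first exact: trigpolyD.
  by apply/funext => x; rewrite /h /h' mulrDr.
rewrite (_ : (fun _ => _) = fun x =>
   (k * k' / 2) * cos (\sum_w (c w + c' w) * x w + (phi + phi')) +
   (k * k' / 2) * cos (\sum_w (c w - c' w) * x w + (phi - phi'))).
  by apply: trigpolyD; exact: trigpoly_cos.
apply/funext => x.
set A := \sum_w c w * x w + phi; set B := \sum_w c' w * x w + phi'.
have -> : \sum_w (c w + c' w) * x w + (phi + phi') = A + B.
  rewrite /A /B addrACA -big_split/=; congr (_ + _).
  by apply: eq_bigr => w _; rewrite mulrDl.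
have -> : \sum_w (c w - c' w) * x w + (phi - phi') = A - B.
  rewrite /A /B opprD addrACA -sumrB/=; congr (_ + _).
  by apply: eq_bigr => w _; rewrite mulrBl.
by rewrite (cosD A B) (cosB A B); field.
Qed.

Lemma trigpoly_bounded f : trigpoly f -> exists2 M : R, 0 <= M & forall x, `|f x| <= M.
Proof.
elim=> [k c phi|{}f g _ [M M0 fM] _ [N N0 gN]].
  by exists `|k| => // x; rewrite normrM ler_piMr// cos_max.
exists (M + N); first exact: addr_ge0.
by move=> x; rewrite (le_trans (ler_normD _ _))// lerD.
Qed.

(** The uniform closure of [trigpoly]; the bound is carried along for products and for rescaling
    into [-1, 1] before [abs_poly]. *)
Definition trigapprox f := (exists2 M : R, 0 <= M & forall x, `|f x| <= M) /\
  forall e : R, 0 < e -> exists2 p, trigpoly p & forall x, `|f x - p x| <= e.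

Lemma trigpoly_approx f : trigpoly f -> trigapprox f.
Proof.
move=> tf; split; first exact: trigpoly_bounded.
by move=> e e0; exists f => // x; rewrite subrr normr0 ltW.
Qed.

Lemma trigapprox_sin k l w : trigapprox (fun x => k * sin (x w * l)).
Proof.
apply: trigpoly_approx; rewrite (_ : (fun _ => _) =
  fun x => k * cos (\sum_i (if i == w then l else 0) * x i + - (pi / 2))).
  exact: trigpoly_cos.
apply/funext => x; rewrite (bigD1 w)//= eqxx big1 ?addr0.
  by rewrite cosBpihalf mulrC [l * _]mulrC mulrC.
by move=> i /negbTE ->; rewrite mul0r.
Qed.

Lemma trigapprox_cst k : trigapprox (fun=> k).
Proof.
apply: trigpoly_approx; rewrite (_ : (fun _ => _) =
  fun x => k * cos (\sum_(i : W) 0 * x i + 0)); first exact: trigpoly_cos.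
by apply/funext => x; rewrite big1 ?addr0 ?cos0 ?mulr1// => i _; rewrite mul0r.
Qed.

Lemma trigapproxD f g :
  trigapprox f -> trigapprox g -> trigapprox (fun x => f x + g x).
Proof.
move=> [[M M0 fM] fa] [[N N0 gN] ga]; split.
  exists (M + N); first exact: addr_ge0.
  by move=> x; rewrite (le_trans (ler_normD _ _))// lerD.
move=> e e0; have e20 : 0 < e / 2 by rewrite divr_gt0.
have [p tp fp] := fa _ e20; have [q tq gq] := ga _ e20.
exists (fun x => p x + q x); first exact: trigpolyD.
move=> x; rewrite opprD addrACA (le_trans (ler_normD _ _))//.
by rewrite [leRHS]splitr lerD.
Qed.

Lemma trigapproxM f g :
  trigapprox f -> trigapprox g -> trigapprox (fun x => f x * g x).
Proof.
move=> [[M M0 fM] fa] [[N N0 gN] ga]; split.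
  exists (M * N); first exact: mulr_ge0.
  by move=> x; rewrite normrM ler_pM.
move=> e e0; have M1 : 0 < M + 1 by rewrite ltr_wpDl.
have e20 : 0 < e / 2 by rewrite divr_gt0.
(* The order matters: [q] is chosen first because the tolerance for [p] depends on a bound of
   [q]. *)
have [q tq gq] := ga _ (divr_gt0 e20 M1).
have [K K0 qK] := trigpoly_bounded tq.
have K1 : 0 < K + 1 by rewrite ltr_wpDl.
have [p tp fp] := fa _ (divr_gt0 e20 K1).
exists (fun x => p x * q x); first exact: trigpolyM.
move=> x; have -> : f x * g x - p x * q x = f x * (g x - q x) + (f x - p x) * q x.
  by ring.
rewrite (le_trans (ler_normD _ _))// [leRHS]splitr lerD//.
- rewrite normrM (@le_trans _ _ ((M + 1) * (e / 2 / (M + 1))))//.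
    by rewrite ler_pM// (le_trans (fM x))// lerDl.
  by rewrite mulrC divfK// gt_eqF.
- rewrite normrM (@le_trans _ _ ((e / 2 / (K + 1)) * (K + 1)))//.
    by rewrite ler_pM// (le_trans (qK x))// lerDl.
  by rewrite divfK// gt_eqF.
Qed.

Lemma trigapproxZ k f : trigapprox f -> trigapprox (fun x => k * f x).
Proof. by move=> af; apply: (trigapproxM (trigapprox_cst k)). Qed.

Lemma trigapprox_unif f :
  (forall e : R, 0 < e -> exists2 g, trigapprox g & forall x, `|f x - g x| <= e) ->
  trigapprox f.
Proof.
move=> H; split.
  have [g [[M M0 gM] _] fg] := H 1 ltr01.
  exists (1 + M) => [|x]; first exact: addr_ge0.
  by rewrite -(subrK (g x) (f x)) (le_trans (ler_normD _ _))// lerD.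
move=> e e0; have e20 : 0 < e / 2 by rewrite divr_gt0.
have [g [_ ga] fg] := H _ e20; have [p tp gp] := ga _ e20.
exists p => // x; rewrite -(subrK (g x) (f x)) -addrA.
by rewrite (le_trans (ler_normD _ _))// [leRHS]splitr lerD.
Qed.

Lemma trigapprox_abs_poly k f :
  trigapprox f -> trigapprox (fun x => abs_poly k (f x)).
Proof.
move=> af; elim: k => [|k IH] /=; first exact: trigapprox_cst.
apply: trigapproxD => //.
rewrite (_ : (fun _ => _) = fun x => 2^-1 * (f x * f x +
   (- 1) * (abs_poly k (f x) * abs_poly k (f x)))).
  apply: trigapproxZ; apply: trigapproxD; first exact: trigapproxM.
  by apply: trigapproxZ; exact: trigapproxM.
by apply/funext => x; rewrite mulrC !expr2 mulN1r.
Qed.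

Lemma trigapprox_norm f : trigapprox f -> trigapprox (fun x => `|f x|).
Proof.
move=> af; have [[M M0 fM] _] := af.
have M1 : 0 < M + 1 by rewrite ltr_wpDl.
apply: trigapprox_unif => e e0.
(* Chosen so that the error [(M + 1) * 2 / (k + 2)] of the rescaled approximation is at most [e]. *)
pose k := Num.truncn (2 * (M + 1) / e).
exists (fun x => (M + 1) * abs_poly k ((M + 1)^-1 * f x)).
  by apply: trigapproxZ; apply: trigapprox_abs_poly; exact: trigapproxZ.
move=> x; have f1 : `|(M + 1)^-1 * f x| <= 1.
  rewrite normrM normfV (gtr0_norm M1) mulrC ler_pdivrMr// mul1r.
  by rewrite (le_trans (fM x))// lerDl.
have [/andP[p0 pf] pe] := abs_poly_bound k f1.
have -> : `|f x| = (M + 1) * `|(M + 1)^-1 * f x|.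
  by rewrite normrM normfV (gtr0_norm M1) mulVKf// gt_eqF.
rewrite -mulrBr normrM (gtr0_norm M1) ger0_norm ?subr_ge0//.
rewrite mulrC -ler_pdivlMr// (le_trans pe)//.
rewrite ler_pdivlMr// mulrAC ler_pdivrMr ?ltr0n//.
rewrite -ler_pdivrMl// mulrC (le_trans (ltW (truncnS_gt _)))//.
by rewrite ler_nat.
Qed.

Lemma trigapprox_max f g :
  trigapprox f -> trigapprox g -> trigapprox (fun x => Num.max (f x) (g x)).
Proof.
move=> af ag; rewrite (_ : (fun _ => _) = fun x => 2^-1 * (f x + g x +
   `|f x + (- 1) * g x|)).
  apply: trigapproxZ; apply: trigapproxD; first exact: trigapproxD.
  by apply: trigapprox_norm; apply: trigapproxD => //; exact: trigapproxZ.
by apply/funext => x; rewrite mulN1r mulrC maxr_absE.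
Qed.

End trigonometric_approximation.

(** * Lattice functions determine the law *)

Section lattice_functions.
Context {R : realType} (W : finType).
Implicit Types (F G : (W -> R) -> R) (x : W -> R).

(** Piecewise linear functions given by their syntax, so that Lipschitz bounds, measurability and
    approximability all follow by induction. *)
Inductive latfun : ((W -> R) -> R) -> Prop :=
| latfun_cst k : latfun (fun=> k)
| latfun_coord w : latfun (fun x => x w)
| latfunD F G : latfun F -> latfun G -> latfun (fun x => F x + G x)
| latfunZ k F : latfun F -> latfun (fun x => k * F x)
| latfun_max F G : latfun F -> latfun G -> latfun (fun x => Num.max (F x) (G x)).

Lemma latfunB F G : latfun F -> latfun G -> latfun (fun x => F x - G x).
Proof.
move=> lF lG; rewrite (_ : (fun _ => _) = fun x => F x + (- 1) * G x).
  by apply: latfunD => //; exact: latfunZ.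
by apply/funext => x; rewrite mulN1r.
Qed.

Lemma latfunN F : latfun F -> latfun (fun x => - F x).
Proof.
move=> lF; rewrite (_ : (fun _ => _) = fun x => (- 1) * F x); first exact: latfunZ.
by apply/funext => x; rewrite mulN1r.
Qed.

Lemma latfun_min F G :
  latfun F -> latfun G -> latfun (fun x => Num.min (F x) (G x)).
Proof.
move=> lF lG; rewrite (_ : (fun _ => _) = fun x => - Num.max (- F x) (- G x)).
  by apply: latfunN; apply: latfun_max; exact: latfunN.
by apply/funext => x; rewrite oppr_max !opprK.
Qed.

Lemma latfun_bigmax (I : Type) (r : seq I) (Q : pred I) F0 (F : I -> (W -> R) -> R) :
  latfun F0 -> (forall i, latfun (F i)) ->
  latfun (fun x => \big[Num.max/F0 x]_(i <- r | Q i) F i x).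
Proof.
move=> l0 lF; elim: r => [|i r IH].
  by under [X in latfun X]eq_fun do rewrite big_nil.
under [X in latfun X]eq_fun do rewrite big_cons.
by case: (Q i) => //; apply: latfun_max.
Qed.

Lemma ler_dist_max (a b c e : R) :
  `|Num.max a b - Num.max c e| <= `|a - c| + `|b - e|.
Proof.
wlog h : a b c e / Num.max c e <= Num.max a b => [hw|].
  have [|/ltW] := leP (Num.max c e) (Num.max a b); first exact: hw.
  by move=> /hw; rewrite distrC (distrC a) (distrC b).
rewrite ger0_norm ?subr_ge0// lerBlDr; move: h => _.
have := ler_norm (a - c); have := ler_norm (b - e).
have := normr_ge0 (a - c); have := normr_ge0 (b - e).
rewrite ge_max; case: (leP c e) => ? *; apply/andP; split; lra.
Qed.

(** Serves twice: for the pointwise limit along [sinbox], and for the integrable dominating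
    function. *)
Lemma latfun_lipschitz F : latfun F ->
  exists2 K : R, 0 <= K & forall x y, `|F x - F y| <= K * \sum_w `|x w - y w|.
Proof.
elim=> [k|w|{}F G _ [K K0 FK] _ [L L0 GL]|k {}F _ [K K0 FK]|
  {}F G _ [K K0 FK] _ [L L0 GL]].
- by exists 0 => // x y; rewrite subrr normr0 mul0r.
- by exists 1 => // x y; rewrite mul1r (bigD1 w)//= lerDl sumr_ge0.
- exists (K + L) => [|x y]; first exact: addr_ge0.
  by rewrite opprD addrACA (le_trans (ler_normD _ _))// mulrDl lerD.
- exists (`|k| * K) => [|x y]; first exact: mulr_ge0.
  by rewrite -mulrBr normrM -mulrA ler_wpM2l.
- exists (K + L) => [|x y]; first exact: addr_ge0.
  by rewrite (le_trans (ler_dist_max _ _ _ _))// mulrDl lerD.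
Qed.

Lemma latfun_measurable d (T : measurableType d) (X : W -> T -> R) F :
  (forall w, measurable_fun setT (X w)) -> latfun F ->
  measurable_fun setT (fun z => F (X^~ z)).
Proof.
move=> mX; elim=> [k|w|{}F G _ mF _ mG|k {}F _ mF|{}F G _ mF _ mG] //=.
- exact: measurable_funD.
- exact: measurable_funM.
- exact: measurable_maxr.
Qed.

(** A bounded substitute for the coordinates that is itself trigonometric, is dominated by [|x w|],
    and tends to [x w] as [L] grows. *)
Definition sinbox (L : R) x : W -> R := fun w => L * sin (x w * L^-1).

Lemma latfun_trigapprox L F : latfun F -> trigapprox (fun x => F (sinbox L x)).
Proof.
elim=> [k|w|{}F G _ aF _ aG|k {}F _ aF|{}F G _ aF _ aG].
- exact: trigapprox_cst.
- exact: trigapprox_sin.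
- exact: trigapproxD.
- exact: trigapproxZ.
- exact: trigapprox_max.
Qed.

Lemma measurable_sinbox d (T : measurableType d) (X : W -> T -> R) L :
  (forall w, measurable_fun setT (X w)) ->
  forall w, measurable_fun setT (fun z => sinbox L (X^~ z) w).
Proof.
move=> mX w; apply: measurable_funM => //.
apply: measurableT_comp; last exact: measurable_funM.
exact: (continuous_measurable_fun (@continuous_sin R)).
Qed.

Lemma cvg_latfun_sinbox F x : latfun F ->
  F (sinbox n.+1%:R x) @[n --> \oo] --> F x.
Proof.
move=> /latfun_lipschitz[K K0 FK].
pose M := K * \sum_w `|x w| ^+ 3.
apply/cvgrPdist_le => e e0; exists (Num.truncn (M / e)) => // n /= Mn.
have n0 : 0 < n.+1%:R :> R by rewrite ltr0n.
rewrite distrC (le_trans (FK _ _))// (@le_trans _ _ (M / n.+1%:R))//.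
  rewrite /M -mulrA ler_wpM2l// mulr_suml ler_sum// => w _.
  by apply: sin_div_dist_le; rewrite ler1n.
rewrite ler_pdivrMr// mulrC -ler_pdivrMr//.
by rewrite (le_trans (ltW (truncnS_gt _)))// ler_nat.
Qed.

End lattice_functions.

(** * From equal cosine integrals to equal means of lattice functions *)

Section same_law.
Context {R : realType} d (T : measurableType d) (Q : probability T R).

Lemma integrable_bounded (f : T -> R) (M : R) : measurable_fun setT f ->
  (forall z, `|f z| <= M) -> Q.-integrable setT (EFin \o f).
Proof.
move=> mf fM; have M0 : 0 <= M by exact: le_trans (fM point).
apply: (le_integrable measurableT _ _ (finite_measure_integrable_cst Q M measurableT)).
  exact/measurable_EFinP.
by move=> z _ /=; rewrite lee_fin (ger0_norm M0).
Qed.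

Lemma Rintegral_dist_le (f g : T -> R) (e : R) :
  Q.-integrable setT (EFin \o f) -> Q.-integrable setT (EFin \o g) ->
  (forall z, `|f z - g z| <= e) ->
  `|(\int[Q]_z f z) - (\int[Q]_z g z)| <= e.
Proof.
move=> If Ig fge; rewrite -RintegralB//.
have Ifg : Q.-integrable setT (EFin \o (fun z => f z - g z)).
  by apply: eq_integrable (integrableB measurableT If Ig).
rewrite (le_trans (le_normr_Rintegral _ Ifg))//.
have Ie := finite_measure_integrable_cst Q e measurableT.
have := le_Rintegral measurableT (integrable_norm Ifg) Ie (fun z _ => fge z).
have := Rintegral_cst Q measurableT e.
by rewrite [X in fine X]probability_setT mulr1 => ->.
Qed.

Context (W : finType) (X Y : W -> T -> R).
Hypotheses (mX : forall w, measurable_fun setT (X w))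
           (mY : forall w, measurable_fun setT (Y w)).
Hypothesis eq_cos : forall (c : W -> R) (phi : R),
  \int[Q]_z cos (\sum_w c w * X w z + phi) =
  \int[Q]_z cos (\sum_w c w * Y w z + phi).

Lemma measurable_cos_comp (Z : W -> T -> R) c phi :
  (forall w, measurable_fun setT (Z w)) ->
  measurable_fun setT (fun z => cos (\sum_w c w * Z w z + phi)).
Proof.
move=> mZ; apply: measurableT_comp.
  exact: (continuous_measurable_fun (@continuous_cos R)).
apply: measurable_funD => //; apply: measurable_sum => w.
exact: measurable_funM.
Qed.

Lemma trigpoly_measurable (Z : W -> T -> R) p :
  (forall w, measurable_fun setT (Z w)) -> trigpoly p ->
  measurable_fun setT (fun z => p (Z^~ z)).
Proof.
move=> mZ; elim=> [k c phi|f g _ mf _ mg]; last exact: measurable_funD.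
by apply: measurable_funM => //; exact: measurable_cos_comp.
Qed.

Lemma trigpoly_integrable (Z : W -> T -> R) p :
  (forall w, measurable_fun setT (Z w)) -> trigpoly p ->
  Q.-integrable setT (EFin \o (fun z => p (Z^~ z))).
Proof.
move=> mZ tp; have [M _ pM] := trigpoly_bounded tp.
by apply: (@integrable_bounded _ M) => //; exact: trigpoly_measurable.
Qed.

Lemma trigpoly_same_Rintegral p : trigpoly p ->
  \int[Q]_z p (X^~ z) = \int[Q]_z p (Y^~ z).
Proof.
elim=> [k c phi|f g tf IHf tg IHg].
  rewrite !RintegralZl//.
  - by rewrite eq_cos.
  - apply: (@integrable_bounded _ 1); first exact: measurable_cos_comp.
    by move=> z; exact: cos_max.
  - apply: (@integrable_bounded _ 1); first exact: measurable_cos_comp.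
    by move=> z; exact: cos_max.
by rewrite !RintegralD ?IHf ?IHg//; exact: trigpoly_integrable.
Qed.

Lemma trigapprox_same_Rintegral f :
  measurable_fun setT (fun z => f (X^~ z)) ->
  measurable_fun setT (fun z => f (Y^~ z)) -> trigapprox f ->
  \int[Q]_z f (X^~ z) = \int[Q]_z f (Y^~ z).
Proof.
move=> mfX mfY [[M M0 fM] fa]; apply/eqP; rewrite -subr_eq0 -normr_le0.
apply/ler_addgt0Pr => e e0; rewrite add0r.
have e20 : 0 < e / 2 by rewrite divr_gt0.
have [p tp fp] := fa _ e20.
rewrite -(subrK (\int[Q]_z p (X^~ z)) (\int[Q]_z f (X^~ z))) -addrA.
rewrite (le_trans (ler_normD _ _))// [leRHS]splitr lerD//.
  apply: Rintegral_dist_le => //; last exact: trigpoly_integrable.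
  exact: (@integrable_bounded _ M).
rewrite trigpoly_same_Rintegral// distrC.
apply: Rintegral_dist_le => //; last exact: trigpoly_integrable.
exact: (@integrable_bounded _ M).
Qed.

Hypotheses (iX : forall w, Q.-integrable setT (EFin \o X w))
           (iY : forall w, Q.-integrable setT (EFin \o Y w)).

(** Dominated convergence: the Lipschitz bound gives [|F (sinbox L x)| <= |F 0| + K * sum |x w|]
    uniformly in [L > 0]. *)
Lemma latfun_sinbox_cvg (Z : W -> T -> R) F :
  (forall w, Q.-integrable setT (EFin \o Z w)) -> latfun F ->
  (\int[Q]_z (F (sinbox n.+1%:R (Z^~ z)))%:E)%E @[n --> \oo] -->
  (\int[Q]_z (F (Z^~ z))%:E)%E.
Proof.
move=> iZ lF; have [K K0 FK] := latfun_lipschitz lF.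
have mZ w : measurable_fun setT (Z w).
  by apply/measurable_EFinP; exact: (measurable_int Q (iZ w)).
pose g z := `|F (fun=> 0)| + K * \sum_w `|Z w z|.
have ig : Q.-integrable setT (EFin \o g).
  have i2 : Q.-integrable setT (fun z => (K%:E * \sum_w (`|Z w z|)%:E)%E).
    apply: integrableZl => //; apply: integrable_sum => // w _.
    exact: (integrable_norm (iZ w)).
  have := integrableD measurableT
    (finite_measure_integrable_cst Q `|F (fun=> 0)| measurableT) i2.
  apply: eq_integrable => // z _.
  by rewrite /= /g sumEFin -EFinM EFinD.
have [|||||_ _ //] := @dominated_convergence _ _ _ Q setT measurableT
  (fun n z => (F (sinbox n.+1%:R (Z^~ z)))%:E) (fun z => (F (Z^~ z))%:E) (EFin \o g).
- move=> n; apply/measurable_EFinP.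
  exact: (latfun_measurable (X := fun w z => sinbox n.+1%:R (Z^~ z) w)
     (measurable_sinbox _ mZ) lF).
- by apply/measurable_EFinP; exact: latfun_measurable.
- apply: aeW => z _; apply: cvg_EFin; first by near=> n.
  exact: cvg_latfun_sinbox.
- exact: ig.
- apply: aeW => z n _ /=; rewrite lee_fin /g.
  rewrite -{1}(subrK (F (fun=> 0)) (F _)) addrC (le_trans (ler_normD _ _))//.
  rewrite lerD2l (le_trans (FK _ _))// ler_wpM2l// ler_sum// => w _.
  by rewrite subr0; apply: norm_sin_div_le; rewrite ltr0n.
Unshelve. all: by end_near. Qed.

(* [F] need not be bounded, so it is first evaluated at [L sin (x / L)], which
   makes it a uniform limit of trigonometric polynomials, before [L -> oo]. *)
Lemma latfun_same_integral F : latfun F ->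
  (\int[Q]_z (F (X^~ z))%:E = \int[Q]_z (F (Y^~ z))%:E)%E.
Proof.
move=> lF; have cX := latfun_sinbox_cvg iX lF; have cY := latfun_sinbox_cvg iY lF.
suff EXY : (fun n => \int[Q]_z (F (sinbox n.+1%:R (X^~ z)))%:E)%E =
           (fun n => \int[Q]_z (F (sinbox n.+1%:R (Y^~ z)))%:E)%E.
  by move: cX; rewrite EXY => cX; exact: (cvg_unique _ cX cY).
apply/funext => n; set f := fun x : W -> R => F (sinbox n.+1%:R x).
have af : trigapprox f by exact: latfun_trigapprox.
have mf (Z : W -> T -> R) : (forall w, measurable_fun setT (Z w)) ->
    measurable_fun setT (fun z => f (Z^~ z)).
  move=> mZ; exact: (latfun_measurable (X := fun w z => sinbox n.+1%:R (Z^~ z) w)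
     (measurable_sinbox _ mZ) lF).
have [M _ fM] := af.1.
have If (Z : W -> T -> R) : (forall w, measurable_fun setT (Z w)) ->
    Q.-integrable setT (EFin \o (fun z => f (Z^~ z))).
  by move=> mZ; apply: (@integrable_bounded _ M) => //; exact: mf.
rewrite -[LHS](fineK (integrable_fin_num measurableT (If _ mX))).
rewrite -[RHS](fineK (integrable_fin_num measurableT (If _ mY))).
by congr EFin; exact: trigapprox_same_Rintegral (mf _ mX) (mf _ mY) af.
Qed.

End same_law.

(** * Rotation invariance *)

Section rmax.
Context {R : realType} (V : finType).
Implicit Types (S : {set V}) (x : V -> R) (v : V).

(** Starting from [x v0] keeps the maximum real valued; for [v0] in [S] this start does not change
    its value. *)
Definition rmax v0 S x : R := \big[Num.max/x v0]_(v in S) x v.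

Lemma rmax_ge v0 S x v : v \in S -> x v <= rmax v0 S x.
Proof. by move=> vS; exact: le_bigmax_cond. Qed.

Lemma rmax_attained v0 S x : v0 \in S -> exists2 v, v \in S & rmax v0 S x = x v.
Proof.
move=> v0S; have /bigmax_geP[h|[v vS h]] := lexx (rmax v0 S x).
  by exists v0 => //; apply/eqP; rewrite eq_le h rmax_ge.
by exists v => //; apply/eqP; rewrite eq_le h rmax_ge.
Qed.

Lemma field_supE (T : Type) (eta : V -> T -> R) v0 S w : v0 \in S ->
  field_sup eta S w = (rmax v0 S (eta^~ w))%:E.
Proof.
move=> v0S; apply/eqP; rewrite eq_le; apply/andP; split.
  apply: bigmax_le => [|u uS]; first exact: leNye.
  by rewrite lee_fin; exact: (rmax_ge _ (eta^~ w)).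
have [v vS ->] := rmax_attained (eta^~ w) v0S.
exact: (le_bigmax_cond _ (fun v => (eta v w)%:E)).
Qed.

End rmax.

(** * Rotations of a pair of independent copies *)

Section gaussian_pair.
Context {R : realType} d (T : measurableType d) (P : probability T R).
Context (V : finType) (eta : V -> T -> R) (sigma : R).
Hypothesis gauss_eta : centered_gaussian_field P eta.
Hypothesis sigma_gt0 : 0 < sigma.
Hypothesis var_le : forall v, (\int[P]_w (eta v w ^+ 2)%:E <= (sigma ^+ 2)%:E)%E.
Let k2 : \bar R := gaussint 1 (fun x => (x ^+ 2)%:E).
Hypotheses (k2_gt0 : (0 < k2)%E) (k2_lty : (k2 < +oo)%E).

Lemma gaussian_field_measurable v : measurable_fun setT (eta v).
Proof.
have [+ _] := gauss_eta (fun u => if u == v then 1 else 0).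
congr measurable_fun; apply/funext => w.
rewrite (bigD1 v)//= eqxx mul1r big1 ?addr0// => u /negbTE ->.
by rewrite mul0r.
Qed.
Let meta := gaussian_field_measurable.

(* [|y| <= (y^2 / sigma + sigma) / 2] *)
Lemma gaussian_field_abs_le v : (\int[P]_w `|eta v w|%:E <= sigma%:E)%E.
Proof.
have s20 : 0 <= (2 * sigma)^-1 by rewrite invr_ge0 mulr_ge0// ltW.
apply: (@le_trans _ _ (\int[P]_w ((2 * sigma)^-1%:E * (eta v w ^+ 2)%:E + (sigma / 2)%:E))%E).
  apply: ge0_le_integral => //.
  - by apply/measurable_EFinP; exact: measurableT_comp.
  - apply: emeasurable_funD => //; apply: measurable_funeM.
    by apply/measurable_EFinP; exact: measurable_funX.
  - move=> w _; rewrite -EFinM -EFinD lee_fin -(real_normK (num_real (eta v w))).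
    rewrite -subr_ge0; set y := `|_|.
    have -> : (2 * sigma)^-1 * y ^+ 2 + sigma / 2 - y = (2 * sigma)^-1 * (y - sigma) ^+ 2.
      by field; rewrite gt_eqF.
    by rewrite mulr_ge0 ?sqr_ge0.
rewrite ge0_integralD//; last 3 first.
- by move=> w _; rewrite mule_ge0// lee_fin sqr_ge0.
- apply: measurable_funeM.
  by apply/measurable_EFinP; exact: measurable_funX.
- by move=> w _; rewrite lee_fin divr_ge0// ltW.
rewrite ge0_integralZl_EFin//; last 2 first.
- by move=> w _; rewrite lee_fin sqr_ge0.
- by apply/measurable_EFinP; exact: measurable_funX.
rewrite integral_cst// [X in (_ + _ * X)%E]probability_setT mule1.
rewrite (le_trans (leeD2r _ (lee_wpmul2l _ (var_le v))))// ?lee_fin//.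
by rewrite le_eqVlt; apply/orP; left; apply/eqP; field; rewrite gt_eqF.
Qed.

Lemma gaussian_field_integrable v : P.-integrable setT (EFin \o eta v).
Proof.
apply/integrableP; split; first exact/measurable_EFinP.
by rewrite (le_lt_trans (gaussian_field_abs_le v))// ltry.
Qed.

Lemma integrable_comp_fst (f : T -> R) : P.-integrable setT (EFin \o f) ->
  (P \x P)%E.-integrable setT (EFin \o (fun z : T * T => f z.1)).
Proof.
move=> /integrableP[/measurable_EFinP mf fi]; apply/integrableP.
have mg : measurable_fun setT (fun z : T * T => f z.1) by exact: measurableT_comp.
split; first exact/measurable_EFinP.
rewrite fubini_tonelli1//=; last by apply/measurable_EFinP; exact: measurableT_comp.
apply: le_lt_trans fi; rewrite le_eqVlt; apply/orP; left; apply/eqP.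
apply: eq_integral => x _; rewrite /fubini_F/= integral_cst//.
by rewrite [X in (_ * X)%E]probability_setT mule1.
Qed.

Lemma integrable_comp_snd (f : T -> R) : P.-integrable setT (EFin \o f) ->
  (P \x P)%E.-integrable setT (EFin \o (fun z : T * T => f z.2)).
Proof.
move=> /integrableP[/measurable_EFinP mf fi]; apply/integrableP.
have mg : measurable_fun setT (fun z : T * T => f z.2) by exact: measurableT_comp.
split; first exact/measurable_EFinP.
rewrite fubini_tonelli2//=; last by apply/measurable_EFinP; exact: measurableT_comp.
apply: le_lt_trans fi; rewrite le_eqVlt; apply/orP; left; apply/eqP.
apply: eq_integral => x _; rewrite /fubini_G/= integral_cst//.
by rewrite [X in (_ * X)%E]probability_setT mule1.
Qed.

Section rotation.
Context (W : finType) (pr : W -> V).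

Lemma pairfield_measurable a b w : measurable_fun setT (pairfield eta pr a b w).
Proof.
by apply: measurable_funD; apply: measurable_funM => //; exact: measurableT_comp.
Qed.

Lemma pairfield_integrable a b w :
  (P \x P)%E.-integrable setT (EFin \o pairfield eta pr a b w).
Proof.
have := integrableD measurableT
  (integrableZl measurableT (a w) (integrable_comp_fst (gaussian_field_integrable (pr w))))
  (integrableZl measurableT (b w) (integrable_comp_snd (gaussian_field_integrable (pr w)))).
by apply: eq_integrable.
Qed.

Lemma pairfield_rotation (a b a' b' : W -> R) (F : (W -> R) -> R) :
  (forall u v, a u * a v + b u * b v = a' u * a' v + b' u * b' v) ->
  latfun F ->
  (\int[P \x P]_z (F (pairfield eta pr a b ^~ z))%:E =
   \int[P \x P]_z (F (pairfield eta pr a' b' ^~ z))%:E)%E.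
Proof.
move=> gram; apply: latfun_same_integral;
  [exact: pairfield_measurable|exact: pairfield_measurable|
  |exact: pairfield_integrable|exact: pairfield_integrable].
move=> c phi.
(* Adding 1 gives a nonnegative test function, as [pairfield_lincomb_integral] requires; the
   constant cancels at the end. *)
pose h (x : R) := 1 + cos (x + phi).
have ch : continuous h.
  move=> x; apply: cvgD; first exact: cvg_cst.
  apply: continuous_comp; last exact: continuous_cos.
  by apply: cvgD; [exact: cvg_id|exact: cvg_cst].
have h0 x : 0 <= h x by have := cos_geN1 (x + phi); rewrite /h; lra.
have := pairfield_lincomb_integral pr gauss_eta k2_gt0 k2_lty c gram ch h0.
have split_int (a0 b0 : W -> R) :
    (\int[P \x P]_z (h (\sum_w c w * pairfield eta pr a0 b0 w z))%:E)%E =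
    (1 + \int[(P \x P)%E]_z (cos (\sum_w c w * pairfield eta pr a0 b0 w z + phi)))%:E.
  have mc := measurable_cos_comp c phi (pairfield_measurable a0 b0).
  have ic : (P \x P)%E.-integrable setT
      (EFin \o (fun z => cos (\sum_w c w * pairfield eta pr a0 b0 w z + phi))).
    by apply: (@integrable_bounded _ _ _ _ _ 1) => // z; exact: cos_max.
  have i1 : (P \x P)%E.-integrable setT (EFin \o cst (1 : R)).
    by apply: (@integrable_bounded _ _ _ _ _ 1) => // z; rewrite normr1.
  have I1 : (\int[P \x P]_z (EFin \o cst 1%R) z = 1)%E.
    by rewrite /= integral_cst// [X in (_ * X)%E]probability_setT mule1.
  rewrite EFinD /Rintegral fineK; last exact: (integrable_fin_num measurableT ic).
  by rewrite -I1 -(integralD measurableT i1 ic).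
by rewrite !split_int => -[] /addrI.
Qed.

End rotation.

End gaussian_pair.

(** * Concentration of the maximum *)

Section concentration.
Context {R : realType} d (T : measurableType d) (P : probability T R).
Context (V : finType) (eta : V -> T -> R) (sigma : R).
Hypothesis gauss_eta : centered_gaussian_field P eta.
Hypothesis sigma_gt0 : 0 < sigma.
Hypothesis var_le : forall v, (\int[P]_w (eta v w ^+ 2)%:E <= (sigma ^+ 2)%:E)%E.
Let k2 : \bar R := gaussint 1 (fun x => (x ^+ 2)%:E).
Hypotheses (k2_gt0 : (0 < k2)%E) (k2_lty : (k2 < +oo)%E).

Let meta := gaussian_field_measurable gauss_eta.

Definition mixture (p q : R) (z : T * T) (v : V) : R :=
  p * eta v z.1 + q * eta v z.2.

Definition bicoef (p p' : R) (w : V * bool) : R := if w.2 then p else p'.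

(** Two mixtures of the same pair, [(p, q)] at [true] and [(p', q')] at [false], so that one lattice
    function can compare them. *)
Definition bifield (p q p' q' : R) : V * bool -> T * T -> R :=
  pairfield eta fst (bicoef p p') (bicoef q q').

(** The three equations say that the vectors [(p, q)] and [(p', q')] have the same Gram matrix as
    [(r, s)] and [(r', s')]. *)
Lemma bifield_rotation p q p' q' r s r' s' (F : (V * bool -> R) -> R) :
  p ^+ 2 + q ^+ 2 = r ^+ 2 + s ^+ 2 -> p * p' + q * q' = r * r' + s * s' ->
  p' ^+ 2 + q' ^+ 2 = r' ^+ 2 + s' ^+ 2 -> latfun F ->
  (\int[P \x P]_z (F (bifield p q p' q' ^~ z))%:E =
   \int[P \x P]_z (F (bifield r s r' s' ^~ z))%:E)%E.
Proof.
move=> h1 h2 h3; apply: (pairfield_rotation gauss_eta sigma_gt0 var_le) => //.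
by move=> [u []] [v []]; rewrite /bicoef /= -?expr2//; nra.
Qed.

Lemma bifield_measurable p q p' q' (F : (V * bool -> R) -> R) : latfun F ->
  measurable_fun setT (fun z => F (bifield p q p' q' ^~ z)).
Proof. by move=> lF; apply: latfun_measurable => // w; exact: pairfield_measurable. Qed.

Section fixed_set.
Context (S : {set V}) (v0 : V).
Hypothesis v0S : v0 \in S.

Let f : (V -> R) -> R := rmax v0 S.

Lemma latfun_rmax (c : bool) :
  latfun (fun x : V * bool -> R => f (fun v => x (v, c))).
Proof.
by apply: latfun_bigmax => [|v]; exact: latfun_coord.
Qed.

Lemma rmax_measurable : measurable_fun setT (fun w => f (eta^~ w)).
Proof.
apply: (@latfun_measurable R V _ T eta f meta).
by apply: latfun_bigmax => [|v]; exact: latfun_coord.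
Qed.

Lemma rmax_integrable : P.-integrable setT (EFin \o (fun w => f (eta^~ w))).
Proof.
have isum : P.-integrable setT (fun w => \sum_v (`|eta v w|)%:E)%E.
  apply: integrable_sum => // v _.
  exact: (integrable_norm (gaussian_field_integrable gauss_eta sigma_gt0 var_le v)).
apply: le_integrable isum => //; first by apply/measurable_EFinP; exact: rmax_measurable.
move=> w _ /=; rewrite sumEFin lee_fin [leRHS]ger0_norm ?sumr_ge0//.
rewrite /f; have [v vS ->] := rmax_attained (eta^~ w) v0S.
by rewrite (bigD1 v)//= lerDl sumr_ge0.
Qed.

Let posdiff (x : V * bool -> R) : R :=
  Num.max (f (fun v => x (v, true)) - f (fun v => x (v, false))) 0.

Let latfun_posdiff : latfun posdiff.
Proof.
apply: latfun_max; last exact: latfun_cst.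
by apply: latfunB; exact: latfun_rmax.
Qed.

(** A one-sided distance between the maxima of two mixtures. Only the positive part is taken, since
    the maximizer of the first mixture bounds the difference from above only. *)
Let D p q p' q' : \bar R := (\int[P \x P]_z (posdiff (bifield p q p' q' ^~ z))%:E)%E.

Let posdiff_ge0 x : 0 <= posdiff x.
Proof. by rewrite le_max lexx orbT. Qed.

Let D_triangle p q p' q' p'' q'' : (D p q p'' q'' <= D p q p' q' + D p' q' p'' q'')%E.
Proof.
rewrite -ge0_integralD//; last 4 first.
- by move=> z _; rewrite lee_fin.
- by apply/measurable_EFinP; exact: bifield_measurable.
- by move=> z _; rewrite lee_fin.
- by apply/measurable_EFinP; exact: bifield_measurable.
apply: ge0_le_integral => //.
- by move=> z _; rewrite lee_fin.
- by apply/measurable_EFinP; exact: bifield_measurable.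
- by apply: emeasurable_funD; apply/measurable_EFinP; exact: bifield_measurable.
- move=> z _; rewrite -EFinD lee_fin /posdiff.
  rewrite -[f (fun v => bifield p q p'' q'' (v, true) z)]/(f (mixture p q z)).
  rewrite -[f (fun v => bifield p q p' q' (v, true) z)]/(f (mixture p q z)).
  rewrite -[f (fun v => bifield p q p'' q'' (v, false) z)]/(f (mixture p'' q'' z)).
  rewrite -[f (fun v => bifield p' q' p'' q'' (v, false) z)]/(f (mixture p'' q'' z)).
  rewrite -[f (fun v => bifield p q p' q' (v, false) z)]/(f (mixture p' q' z)).
  rewrite -[f (fun v => bifield p' q' p'' q'' (v, true) z)]/(f (mixture p' q' z)).
  move: (f (mixture p q z)) (f (mixture p'' q'' z)) (f (mixture p' q' z)) => a b c; rewrite ge_max.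
  have : a - c <= Num.max (a - c) 0 by rewrite le_max lexx.
  have : c - b <= Num.max (c - b) 0 by rewrite le_max lexx.
  have : 0 <= Num.max (a - c) 0 by rewrite le_max lexx orbT.
  have : 0 <= Num.max (c - b) 0 by rewrite le_max lexx orbT.
  by move=> *; apply/andP; split; lra.
Qed.

Let K : \bar R := (\int[P]_w `|f (eta^~ w)|%:E)%E.

Let K_fin : K \is a fin_num.
Proof.
rewrite ge0_fin_numE; last by apply: integral_ge0 => w _; rewrite lee_fin.
by have /integrableP[_] := rmax_integrable.
Qed.

(* At fixed first coordinate the maximizer of [eta] is a fixed index, along which
   the increment is a single Gaussian variable in the second coordinate. *)
Let D_step c s : 0 <= c <= 1 -> 0 <= s ->
  (D 1 0 c s <= (1 - c)%:E * K + (s * sigma)%:E)%E.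
Proof.
move=> /andP[c0 c1] s0; rewrite /D.
have mp : measurable_fun setT (fun z => (posdiff (bifield 1 0 c s ^~ z))%:E).
  by apply/measurable_EFinP; exact: bifield_measurable.
have p0 z : (0 <= (posdiff (bifield 1 0 c s ^~ z))%:E)%E by rewrite lee_fin.
rewrite fubini_tonelli1//.
have mabs : measurable_fun setT (fun w => (`|f (eta^~ w)|)%:E).
  by apply/measurable_EFinP; apply: measurableT_comp => //; exact: rmax_measurable.
have c10 : 0 <= 1 - c by rewrite subr_ge0.
apply: (@le_trans _ _ (\int[P]_w ((1 - c)%:E * `|f (eta^~ w)|%:E + (s * sigma)%:E))%E).
  apply: ge0_le_integral => //.
  - by move=> w _; apply: integral_ge0.
  - exact: measurable_fun_fubini_tonelli_F.
  - by apply: emeasurable_funD => //; exact: measurable_funeM.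
  - move=> x _; have [v vS fx] := rmax_attained (eta^~ x) v0S.
    apply: (@le_trans _ _ (\int[P]_y (((1 - c) * `|f (eta^~ x)|)%:E + s%:E * `|eta v y|%:E))%E).
      apply: ge0_le_integral => //.
      - exact: measurableT_comp mp (pair1_measurable x).
      - apply: emeasurable_funD => //; apply: measurable_funeM.
        by apply/measurable_EFinP; exact: measurableT_comp.
      - move=> y _; rewrite -EFinM -EFinD lee_fin /posdiff.
        rewrite -[f (fun v => bifield 1 0 c s (v, false) (x, y))]/(f (mixture c s (x, y))).
        have -> : f (fun v => bifield 1 0 c s (v, true) (x, y)) = f (eta^~ x).
          congr f; apply/funext => u.
          by rewrite /bifield /pairfield/= /bicoef/= mul1r mul0r addr0.
        have : c * eta v x + s * eta v y <= f (mixture c s (x, y)).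
          exact: (rmax_ge v0 (mixture c s (x, y)) vS).
        have h1 : f (eta^~ x) = eta v x := fx.
        have := ler_norm (f (eta^~ x)); have := ler_norm (- eta v y).
        rewrite normrN ge_max => h2 h3 h4; apply/andP; split; last first.
          by rewrite addr_ge0// mulr_ge0.
        have : s * - eta v y <= s * `|eta v y| by rewrite ler_wpM2l.
        have : (1 - c) * f (eta^~ x) <= (1 - c) * `|f (eta^~ x)| by rewrite ler_wpM2l.
        rewrite h1; lra.
    rewrite ge0_integralD//; last 3 first.
    - by move=> w _; rewrite lee_fin mulr_ge0.
    - by move=> w _; rewrite mule_ge0// lee_fin.
    - apply: measurable_funeM.
      by apply/measurable_EFinP; exact: measurableT_comp.
    rewrite integral_cst// [X in (_ * X + \int[_]_x _ <= _)%E]probability_setT mule1 -EFinM leeD2l//.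
    rewrite ge0_integralZl_EFin//; last first.
      by apply/measurable_EFinP; exact: measurableT_comp.
    rewrite EFinM lee_wpmul2l ?lee_fin//.
    exact: (gaussian_field_abs_le gauss_eta sigma_gt0 var_le).
rewrite ge0_integralD//; last 3 first.
- by move=> w _; rewrite mule_ge0// lee_fin.
- exact: measurable_funeM.
- by move=> w _; rewrite lee_fin mulr_ge0// ltW.
rewrite integral_cst// [X in (_ + _ * X)%E]probability_setT mule1.
by rewrite ge0_integralZl_EFin.
Qed.

(** The directions at angles [k delta] and [(k + 1) delta] have the Gram matrix of those at 0 and
    [delta], so every rotation step costs the same; [D_triangle] adds the costs. *)
Let D_chain c s k (delta : R) : c = cos delta -> s = sin delta ->
  (D 1 0 (cos (k%:R * delta)) (sin (k%:R * delta)) <= k%:R%:E * D 1 0 c s)%E.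
Proof.
move=> -> ->; elim: k => [|k IH].
  rewrite mul0r cos0 sin0 mul0e le_eqVlt; apply/orP; left; apply/eqP.
  rewrite /D integral0_eq// => z _; congr (_%:E).
  by rewrite /posdiff subrr max_l.
apply: (le_trans (D_triangle _ _ (cos (k%:R * delta)) (sin (k%:R * delta)) _ _)).
have -> : (D (cos (k%:R * delta)) (sin (k%:R * delta)) (cos (k.+1%:R * delta))
    (sin (k.+1%:R * delta)) = D 1 0 (cos delta) (sin delta))%E.
  have hk : k.+1%:R * delta = k%:R * delta + delta by rewrite -natr1 mulrDl mul1r.
  apply: bifield_rotation => //; rewrite ?cos2Dsin2 ?expr1n ?expr0n ?addr0//.
  rewrite hk cosD sinD mul1r mul0r addr0.
  have := cos2Dsin2 (k%:R * delta).
  move: (cos (k%:R * delta)) (sin (k%:R * delta)) => C S0 h.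
  rewrite -[RHS]mul1r -h; ring.
rewrite -natr1 EFinD ge0_muleDl ?lee_fin// mul1e leeD2r//.
Qed.

Let D_quarter : (D 1 0 0 1 <= ((pi + 1) / 2 * sigma)%:E)%E.
Proof.
pose k := fine K; have k0 : 0 <= k by rewrite fine_ge0// integral_ge0.
(* With this [N], [delta * k * (pi / 2) <= sigma]: over all [N] steps the cosine terms cost at most
   [sigma / 2], and the sine terms at most [(pi / 2) sigma]. *)
pose N := (Num.truncn (pi ^+ 2 * k / (4 * sigma))).+1.
pose delta : R := pi / 2 / N%:R.
have N0 : 0 < N%:R :> R by rewrite ltr0n.
have N1 : 1 <= N%:R :> R by rewrite ler1n.
have pi20 : 0 < pi / 2 :> R by rewrite divr_gt0// pi_gt0.
have Nd : N%:R * delta = pi / 2 by rewrite mulrC divfK// gt_eqF.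
have d0 : 0 < delta by rewrite divr_gt0.
have dpi : delta <= pi / 2 by rewrite ler_pdivrMr// ler_peMr// ltW.
have c0 : 0 <= cos delta.
  by rewrite cos_ge0_pihalf// dpi andbT (le_trans _ (ltW d0))// oppr_le0 ltW.
have s0 : 0 <= sin delta.
  by rewrite sin_ge0_pi// (ltW d0)/= (le_trans dpi)// ler_pdivrMr// ler_peMr ?pi_ge0// ler1n.
have sd : sin delta <= delta.
  by rewrite (le_trans (ler_norm _))// (le_trans (norm_sin_le _))// gtr0_norm.
have := D_chain N (erefl (cos delta)) (erefl (sin delta)).
rewrite Nd cos_pihalf sin_pihalf => /le_trans; apply.
apply: (@le_trans _ _ (N%:R%:E * ((1 - cos delta)%:E * K + (sin delta * sigma)%:E))%E).
  by rewrite lee_wpmul2l ?lee_fin// D_step// c0 cos_le1.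
rewrite -(fineK K_fin) -/k -(EFinM (1 - cos delta)) -EFinD -EFinM lee_fin.
have h1 : (1 - cos delta) * k <= delta ^+ 2 / 2 * k by rewrite ler_wpM2r// onem_cos_le.
have h2 : sin delta * sigma <= delta * sigma by rewrite ler_wpM2r// ltW.
apply: (@le_trans _ _ (N%:R * (delta ^+ 2 / 2 * k + delta * sigma))).
  by rewrite ler_wpM2l ?lerD// ltW.
have -> : N%:R * (delta ^+ 2 / 2 * k + delta * sigma) =
    (N%:R * delta) * (delta * k / 2 + sigma) by field.
rewrite Nd; have : delta * k * (pi / 2) <= sigma.
  have -> : delta * k * (pi / 2) = (pi ^+ 2 * k / 4) / N%:R.
    by rewrite /delta; field; rewrite gt_eqF.
  rewrite ler_pdivrMr// -ler_pdivrMl//.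
  have -> : sigma^-1 * (pi ^+ 2 * k / 4) = pi ^+ 2 * k / (4 * sigma).
    by field; rewrite gt_eqF.
  exact: ltW (truncnS_gt _).
lra.
Qed.

(** Replacing the mean by an independent copy can only increase the deviation. The absolute
    difference of the two maxima then splits into [D 1 0 0 1] and [D 0 1 1 0], equal by rotation. *)
Lemma rmax_deviation :
  (\int[P]_w `|f (eta^~ w) - fine (\int[P]_y (f (eta^~ y))%:E)|%:E
    <= ((pi + 1) * sigma)%:E)%E.
Proof.
set m := fine _; have If := rmax_integrable.
have mf := rmax_measurable.
have mg : measurable_fun setT (fun z : T * T => (`|f (eta^~ z.1) - f (eta^~ z.2)|)%:E).
  apply/measurable_EFinP; apply: measurableT_comp => //.
  by apply: measurable_funB;
    [exact: measurableT_comp mf measurable_fst|exact: measurableT_comp mf measurable_snd].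
have g0 (z : T * T) : (0 <= (`|f (eta^~ z.1) - f (eta^~ z.2)|)%:E)%E by rewrite lee_fin.
apply: (@le_trans _ _ (\int[P \x P]_z `|f (eta^~ z.1) - f (eta^~ z.2)|%:E)%E).
  rewrite fubini_tonelli1//; apply: ge0_le_integral => //.
  - by apply/measurable_EFinP; apply: measurableT_comp => //; exact: measurable_funB.
  - exact: measurable_fun_fubini_tonelli_F.
  - move=> x _; rewrite /fubini_F/=.
    have ic : P.-integrable setT (EFin \o cst (f (eta^~ x))).
      exact: finite_measure_integrable_cst.
    have E : (\int[P]_y ((f (eta^~ x))%:E - (f (eta^~ y))%:E) = (f (eta^~ x) - m)%:E)%E.
      rewrite (integralB measurableT ic If) /= integral_cst//.
      rewrite [X in (_ * X - _)%E]probability_setT mule1 EFinB /m fineK//.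
      exact: (integrable_fin_num measurableT If).
    have mxy : measurable_fun setT (fun y => ((f (eta^~ x))%:E - (f (eta^~ y))%:E)%E).
      by apply: emeasurable_funB => //; exact/measurable_EFinP.
    by have := le_abse_integral P measurableT mxy; rewrite E.
have -> : (\int[P \x P]_z `|f (eta^~ z.1) - f (eta^~ z.2)|%:E = D 1 0 0 1 + D 0 1 1 0)%E.
  rewrite -ge0_integralD//; last 4 first.
  - by move=> z _; rewrite lee_fin.
  - by apply/measurable_EFinP; exact: bifield_measurable.
  - by move=> z _; rewrite lee_fin.
  - by apply/measurable_EFinP; exact: bifield_measurable.
  apply: eq_integral => z _; rewrite -EFinD; congr (_%:E).
  have E1 c : (fun v => bifield 1 0 0 1 (v, c) z) = eta^~ (if c then z.1 else z.2).
    apply/funext => v; rewrite /bifield /pairfield /bicoef/=.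
    by case: c; rewrite !mul1r !mul0r ?addr0 ?add0r.
  rewrite /posdiff !E1; move: (f (eta^~ z.1)) (f (eta^~ z.2)) => a b.
  have [ab|/ltW ba] := leP a b.
    by rewrite ler0_norm ?subr_le0// opprB max_r ?subr_le0// max_l ?subr_ge0// add0r.
  by rewrite ger0_norm ?subr_ge0// max_l ?subr_ge0// max_r ?subr_le0// addr0.
have -> : D 0 1 1 0 = D 1 0 0 1 by apply: bifield_rotation => //; ring.
rewrite (le_trans (leeD D_quarter D_quarter))// -EFinD lee_fin.
by rewrite le_eqVlt; apply/orP; left; apply/eqP; field.
Qed.

End fixed_set.
End concentration.

(** * Tail bounds for the level set *)

Section integral_bounds.
Context {R : realType} d (T : measurableType d) (P : probability T R).

(** The case of an infinite integral of [h] is settled separately, so [h] only has to be measurable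
    and nonnegative, while [u] may change sign. *)
Lemma le_integral_ge0 (u h : T -> R) :
  P.-integrable setT (EFin \o u) -> measurable_fun setT h ->
  (forall w, 0 <= h w) -> (forall w, u w <= h w) ->
  (\int[P]_w (u w)%:E <= \int[P]_w (h w)%:E)%E.
Proof.
move=> iu mh h0 uh; have [hy|hfin] := leP +oo%E (\int[P]_w (h w)%:E)%E.
  exact: le_trans (leey _) hy.
apply: le_integral => //; last by move=> w _; rewrite lee_fin.
apply/integrableP; split; first exact/measurable_EFinP.
apply: le_lt_trans hfin; rewrite le_eqVlt; apply/orP; left; apply/eqP.
by apply: eq_integral => w _ /=; rewrite ger0_norm.
Qed.

(** Markov's inequality for the conditional mean given the first copy; [B] will be an event about
    the level set of that copy. *)
Lemma section_markov (h : T * T -> R) (B : set T) (c : R) :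
  measurable_fun setT h -> (forall z, 0 <= h z) -> measurable B -> 0 <= c ->
  (forall x, B x -> (c%:E <= \int[P]_y (h (x, y))%:E)%E) ->
  (c%:E * P B <= \int[P \x P]_z (h z)%:E)%E.
Proof.
move=> mh h0 mB c0 hB.
have mhE : measurable_fun setT (fun z => (h z)%:E) by exact/measurable_EFinP.
rewrite fubini_tonelli1//.
have -> : (P B = \int[P]_x (\1_B x)%:E)%E by rewrite integral_indic// setIT.
rewrite -ge0_integralZl_EFin//; last by apply/measurable_EFinP; exact: measurable_indic.
apply: ge0_le_integral => //.
- by move=> x _; rewrite mule_ge0// lee_fin.
- by apply: measurable_funeM; apply/measurable_EFinP; exact: measurable_indic.
- by apply: measurable_fun_fubini_tonelli_F => // z; rewrite lee_fin.
- move=> x _; rewrite indicE; case: (boolP (x \in B)) => [/set_mem/hB xB|_].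
    by rewrite mule1.
  by rewrite mule0; apply: integral_ge0 => y _; rewrite lee_fin.
Qed.

End integral_bounds.

Section level_set_tails.
Context {R : realType} d (T : measurableType d) (P : probability T R).
Context (V : finType) (eta : V -> T -> R) (sigma : R).
Hypothesis gauss_eta : centered_gaussian_field P eta.
Hypothesis sigma_gt0 : 0 < sigma.
Hypothesis var_le : forall v, (\int[P]_w (eta v w ^+ 2)%:E <= (sigma ^+ 2)%:E)%E.
Let k2 : \bar R := gaussint 1 (fun x => (x ^+ 2)%:E).
Hypotheses (k2_gt0 : (0 < k2)%E) (k2_lty : (k2 < +oo)%E).

Let meta := gaussian_field_measurable gauss_eta.
Let C : R := pi + 1.

Lemma gfunE (S : {set V}) v0 : v0 \in S ->
  gfun P eta S = (\int[P]_w (rmax v0 S (eta^~ w))%:E)%E.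
Proof.
move=> v0S; rewrite /gfun; case: ifPn => [/eqP S0|_]; first by rewrite S0 inE in v0S.
by apply: eq_integral => w _; exact: field_supE.
Qed.

Lemma gfun_fin_num (S : {set V}) v0 : v0 \in S -> gfun P eta S \is a fin_num.
Proof.
move=> v0S; rewrite (gfunE v0S); apply: integrable_fin_num => //.
exact: (rmax_integrable gauss_eta sigma_gt0 var_le).
Qed.

Lemma gfun_deviation (S : {set V}) v0 : v0 \in S ->
  (\int[P]_w `|rmax v0 S (eta^~ w) - fine (gfun P eta S)|%:E <= (C * sigma)%:E)%E.
Proof.
by move=> v0S; rewrite (gfunE v0S); exact: (rmax_deviation gauss_eta sigma_gt0 var_le).
Qed.

Let g : R := fine (gfun P eta [set: V]).

(** The level set takes finitely many values, and each value is fixed by finitely many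
    comparisons. *)
Lemma level_set_measurable (alpha : R) (Q : set {set V}) :
  measurable [set w | Q (level_set P eta alpha w)].
Proof.
have -> : [set w | Q (level_set P eta alpha w)] =
    \bigcup_(S in Q) \bigcap_(v in [set: V]%classic)
      [set w | (alpha * g <= eta v w) = (v \in S)].
  apply/seteqP; split => [w Qw|w [S QS h]] /=.
    by exists (level_set P eta alpha w) => // v _ /=; rewrite inE.
  suff -> : level_set P eta alpha w = S by [].
  by apply/setP => v; rewrite inE; exact: h.
apply: fin_bigcup_measurable => [|S _]; first exact: finite_finset.
apply: fin_bigcap_measurable => [|v _]; first exact: finite_finset.
have mle : measurable_fun setT (fun w => alpha * g <= eta v w).
  exact: measurable_fun_ler.
rewrite -[X in measurable X]setTI.
exact: (mle measurableT [set v \in S]).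
Qed.

Variable v0 : V.
Variables alpha eps : R.
Hypotheses (g_gt0 : 0 < g) (alpha01 : 0 < alpha < 1) (eps_gt0 : 0 < eps).
Let U := level_set P eta alpha.
Let b := Num.sqrt (1 - alpha ^+ 2).

Let b2 : alpha ^+ 2 + b ^+ 2 = 1.
Proof.
move: alpha01 => /andP[a0 a1]; rewrite sqr_sqrtr; first by ring.
by rewrite subr_ge0 expr_le1// ltW.
Qed.

Let b_gt0 : 0 < b.
Proof. by rewrite sqrtr_gt0; move: alpha01 => /andP[a0 a1]; nra. Qed.

Let excess (x : V * bool -> R) : R :=
  Num.max (rmax v0 [set: V] (fun v => x (v, true)) - g) 0.

Let latfun_excess : latfun excess.
Proof.
apply: latfun_max; last exact: latfun_cst.
by apply: latfunB; [exact: latfun_rmax|exact: latfun_cst].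
Qed.

Lemma level_set_upper_tail :
  ((b * eps * g)%:E * P [set w | (((b + eps) * g)%:E <= gfun P eta (U w))%E]
    <= (C * sigma)%:E)%E.
Proof.
set B := [set w | _].
have e0 z : 0 <= excess z by rewrite le_max lexx orbT.
pose h z := excess (bifield eta alpha b alpha b ^~ z).
have mh : measurable_fun setT h by exact: (bifield_measurable gauss_eta).
have mB : measurable B.
  exact: (level_set_measurable alpha [set S | (((b + eps) * g)%:E <= gfun P eta S)%E]).
apply: (@le_trans _ _ (\int[P \x P]_z (h z)%:E)%E).
  apply: (section_markov mh (fun z => e0 _) mB) => [|x Bx].
    by rewrite !mulr_ge0// ltW.
  have [U0|[v1 v1U]] := set_0Vmem (U x).
    by move: Bx; rewrite /B/= U0 /gfun eqxx leeNy_eq.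
  have GU := gfun_fin_num v1U.
  have Ug : (b + eps) * g <= fine (gfun P eta (U x)).
    by move: Bx; rewrite /B/= -{1}(fineK GU) lee_fin.
  have iM := rmax_integrable gauss_eta sigma_gt0 var_le v1U.
  have EM : (\int[P]_w (rmax v1 (U x) (eta^~ w))%:E = (fine (gfun P eta (U x)))%:E)%E.
    by rewrite (fineK GU) (gfunE v1U).
  (* Lower bound for the excess, from the maximizer of the second copy over [U x], where the first
     copy is at least [alpha * g]. On the event its mean is at least [b * eps * g]. *)
  pose u y := alpha ^+ 2 * g - g + b * rmax v1 (U x) (eta^~ y).
  have iu1 : P.-integrable setT (EFin \o cst (alpha ^+ 2 * g - g)).
    exact: finite_measure_integrable_cst.
  have iu2 := integrableZl measurableT b iM.
  have iu : P.-integrable setT (EFin \o u).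
    by have := integrableD measurableT iu1 iu2; apply: eq_integrable.
  apply: (@le_trans _ _ (\int[P]_y (u y)%:E)%E).
    rewrite (_ : (fun y => (u y)%:E) = (EFin \o cst (alpha ^+ 2 * g - g)) \+
       (fun y => b%:E * (EFin \o (fun w => rmax v1 (U x) (eta^~ w))) y)%E)//.
    rewrite (integralD measurableT iu1 iu2) (integralZl measurableT iM) /= EM.
    rewrite integral_cst// [X in (_ * X + _)%E]probability_setT mule1 -EFinM -EFinD lee_fin.
    have : b * ((b + eps) * g) <= b * fine (gfun P eta (U x)) by rewrite ler_wpM2l// ltW.
    have : (alpha ^+ 2 + b ^+ 2) * g = g by rewrite b2 mul1r.
    nra.
  apply: (le_integral_ge0 iu (measurableT_comp mh (pair1_measurable x))
    (fun y => e0 _)) => y; rewrite /h /excess le_max; apply/orP; left.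
  have [v vU E] := rmax_attained (eta^~ y) v1U.
  rewrite /u E.
  have : alpha * g <= eta v x by move: vU; rewrite inE.
  have : alpha * eta v x + b * eta v y <=
      rmax v0 [set: V] (fun v => bifield eta alpha b alpha b (v, true) (x, y)).
    exact: (rmax_ge v0 (fun v => bifield eta alpha b alpha b (v, true) (x, y)) (finset.in_setT v)).
  move: alpha01 => /andP[a0 a1] h1 h2.
  have : alpha * (alpha * g) <= alpha * eta v x by rewrite ler_wpM2l// ltW.
  move: h1; lra.
(* Both slots hold the same mixture, so this one equation is the whole Gram condition; the mixture
   becomes [eta] itself. *)
have r1 : alpha ^+ 2 + b ^+ 2 = 1 ^+ 2 + 0 ^+ 2 by rewrite b2; ring.
rewrite /h (bifield_rotation gauss_eta sigma_gt0 var_le k2_gt0 k2_lty r1 r1 r1 latfun_excess).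
have mh1 : measurable_fun setT (fun z => (excess (bifield eta 1 0 1 0 ^~ z))%:E).
  by apply/measurable_EFinP; exact: (bifield_measurable gauss_eta).
rewrite fubini_tonelli1//; last by move=> z; rewrite lee_fin.
apply: le_trans (gfun_deviation (finset.in_setT v0)); apply: ge0_le_integral => //.
- by move=> x _; apply: integral_ge0 => y _; rewrite lee_fin.
- by apply: measurable_fun_fubini_tonelli_F => // z; rewrite lee_fin.
- apply/measurable_EFinP; apply: measurableT_comp => //; apply: measurable_funB => //.
  exact: (rmax_measurable gauss_eta).
- move=> x _; rewrite /fubini_F.
  have E y : (fun v => bifield eta 1 0 1 0 (v, true) (x, y)) = eta^~ x.
    by apply/funext => v; rewrite /bifield /pairfield /bicoef/= mul1r mul0r addr0.
  under eq_integral do rewrite /excess E.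
  rewrite integral_cst// [X in (_ * X)%E]probability_setT mule1 lee_fin.
  by rewrite ge_max ler_norm normr_ge0.
Qed.

(** * Lower tail of [gfun] on the level set *)

Section lower.
Variables a b' c1 : R.
Hypotheses (ab' : a ^+ 2 + b' ^+ 2 = 1) (a_ge0 : 0 <= a) (b'_ge0 : 0 <= b').
Hypotheses (c1_a : c1 <= a - alpha) (c1_b : c1 <= b' - b + eps).
Hypothesis C_le : C * sigma <= c1 * g.

(** The minimum asks one index [v] to be high in both components; [deficit] below measures how far
    the best index fails. *)
Let overlap (x : V * bool -> R) (v : V) : R :=
  Num.min (x (v, true) - a * g) (x (v, false) - b' * g).

Let deficit (x : V * bool -> R) : R :=
  Num.max (- rmax v0 [set: V] (overlap x)) 0.

Let latfun_deficit : latfun deficit.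
Proof.
apply: latfun_max; last exact: latfun_cst.
apply: latfunN; apply: latfun_bigmax => [|v]; apply: latfun_min;
  by apply: latfunB; [exact: latfun_coord|exact: latfun_cst].
Qed.

Let deficit_ge0 x : 0 <= deficit x.
Proof. by rewrite le_max lexx orbT. Qed.

(** Take the index maximizing [overlap]. Outside [U x] its first component misses [a * g] by at
    least [(a - alpha) * g]; inside, its second component misses [b' * g] by at least
    [b' * g - M]. *)
Let deficit_lower x y : forall M : R,
  (forall v, v \in U x -> eta v y <= M) ->
  c1 * g <= deficit (bifield eta 1 0 0 1 ^~ (x, y)) \/
  b' * g - M <= deficit (bifield eta 1 0 0 1 ^~ (x, y)).
Proof.
move=> M UM; set X := fun w => _.
have [v _ E] := rmax_attained (overlap X) (finset.in_setT v0).
have XT : X (v, true) = eta v x.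
  by rewrite /X /bifield /pairfield /bicoef/= mul1r mul0r addr0.
have XF : X (v, false) = eta v y.
  by rewrite /X /bifield /pairfield /bicoef/= mul1r mul0r add0r.
have dE : - overlap X v <= deficit X by rewrite /deficit E le_max lexx.
have o1 : overlap X v <= eta v x - a * g by rewrite /overlap XT ge_min lexx.
have o2 : overlap X v <= eta v y - b' * g by rewrite /overlap XF ge_min lexx orbT.
have [vU|vU] := boolP (v \in U x); [right|left].
  by have := UM _ vU; lra.
have : eta v x < alpha * g by move: vU; rewrite inE -ltNge.
have : c1 * g <= (a - alpha) * g by rewrite ler_wpM2r// ltW.
lra.
Qed.

Let section_deficit x : (gfun P eta (U x) <= ((b - eps) * g)%:E)%E ->
  ((c1 * g - C * sigma)%:E <=
    \int[P]_y (deficit (bifield eta 1 0 0 1 ^~ (x, y)))%:E)%E.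
Proof.
move=> gUx; pose h y := deficit (bifield eta 1 0 0 1 ^~ (x, y)).
have mdef := bifield_measurable gauss_eta 1 0 0 1 latfun_deficit.
have mh : measurable_fun setT h by exact: measurableT_comp mdef (pair1_measurable x).
have mhE : measurable_fun setT (fun y => (h y)%:E) by exact/measurable_EFinP.
have C0 : 0 <= C * sigma by rewrite mulr_ge0 ?(ltW sigma_gt0)// addr_ge0 ?pi_ge0.
have ic : P.-integrable setT (EFin \o cst (c1 * g)).
  exact: finite_measure_integrable_cst.
have Ec : (\int[P]_y (cst (c1 * g) y)%:E = (c1 * g)%:E)%E.
  by rewrite /= integral_cst// [X in (_ * X)%E]probability_setT mule1.
have [U0|[v1 v1U]] := set_0Vmem (U x).
  apply: (@le_trans _ _ (c1 * g)%:E); first by rewrite lee_fin gerBl.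
  rewrite -Ec; apply: (le_integral_ge0 ic mh (fun y => deficit_ge0 _)) => y /=.
  (* Over the empty set any [M] is admissible; this one makes both alternatives equal to
     [c1 * g]. *)
  have := @deficit_lower x y (b' * g - c1 * g).
  by rewrite U0 => -[v|//|]; [rewrite inE|rewrite opprB addrCA subrr addr0].
have GU := gfun_fin_num v1U.
have Ug : fine (gfun P eta (U x)) <= (b - eps) * g.
  by move: gUx; rewrite -{1}(fineK GU) lee_fin.
pose m := fine (gfun P eta (U x)); pose M y := rmax v1 (U x) (eta^~ y).
have mdev : measurable_fun setT (fun y => `|M y - m|).
  apply: measurableT_comp => //; apply: measurable_funB => //.
  exact: (rmax_measurable gauss_eta).
have dev := gfun_deviation v1U.
have : ((c1 * g)%:E <= \int[P]_y (h y)%:E + (C * sigma)%:E)%E.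
  apply: le_trans (leeD2l _ dev).
  rewrite -ge0_integralD//; last 2 first.
  - by move=> y _; rewrite lee_fin; exact: deficit_ge0.
  - exact/measurable_EFinP.
  rewrite -Ec; apply: (le_integral_ge0 (h := fun y => h y + `|M y - m|) ic).
  - exact: measurable_funD.
  - by move=> y; rewrite addr_ge0//; exact: deficit_ge0.
  - move=> y /=.
    have [v|hy|hy] := @deficit_lower x y (M y); first exact: (rmax_ge v1 (eta^~ y)).
      by rewrite (le_trans hy)// lerDl.
    have : c1 * g <= (b' - b + eps) * g by rewrite ler_wpM2r// ltW.
    have := ler_norm (M y - m); move: hy Ug; rewrite -/m -/(h y); lra.
by rewrite EFinB leeBlDr.
Qed.

(** The maximizer [v] of the first copy has shortfall at most [|M - g| + |eta v y|] in both
    components; it does not depend on [y], so the last term has mean at most [sigma]. The factors 2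
    are slack. *)
Let rotated_deficit :
  (\int[P \x P]_z (deficit (bifield eta a b' b' (- a) ^~ z))%:E <=
    ((2 * C + 2) * sigma)%:E)%E.
Proof.
have mdef := bifield_measurable gauss_eta a b' b' (- a) latfun_deficit.
have mdefE : measurable_fun setT (fun z => (deficit (bifield eta a b' b' (- a) ^~ z))%:E).
  exact/measurable_EFinP.
rewrite fubini_tonelli1//; last by move=> z; rewrite lee_fin.
have a1 : a <= 1.
  have : a ^+ 2 <= 1 by rewrite -ab' lerDl sqr_ge0.
  by rewrite expr_le1.
have b'1 : b' <= 1.
  have : b' ^+ 2 <= 1 by rewrite -ab' lerDr sqr_ge0.
  by rewrite expr_le1.
have scaled (c y : R) : 0 <= c -> c <= 1 -> - `|y| <= c * y <= `|y|.
  by move=> c0 c2; rewrite -ler_norml normrM (ger0_norm c0) ler_piMl.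
pose M x := rmax v0 [set: V] (eta^~ x).
have mdev : measurable_fun setT (fun x => `|M x - g|%:E).
  apply/measurable_EFinP; apply: measurableT_comp => //; apply: measurable_funB => //.
  exact: (rmax_measurable gauss_eta).
apply: (@le_trans _ _ (\int[P]_x (2%:E * `|M x - g|%:E + (2 * sigma)%:E))%E).
  apply: ge0_le_integral => //.
  - by move=> x _; apply: integral_ge0 => y _; rewrite lee_fin.
  - by apply: measurable_fun_fubini_tonelli_F => // z; rewrite lee_fin.
  - by apply: emeasurable_funD => //; exact: measurable_funeM.
  - move=> x _; have [v _ E] := rmax_attained (eta^~ x) (finset.in_setT v0).
    have mv : measurable_fun setT (fun y => `|eta v y|%:E).
      by apply/measurable_EFinP; exact: measurableT_comp.
    apply: (@le_trans _ _ (\int[P]_y ((2 * `|M x - g|)%:E + 2%:E * `|eta v y|%:E))%E).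
      apply: ge0_le_integral => //.
      - by move=> y _; rewrite lee_fin.
      - exact: measurableT_comp mdefE (pair1_measurable x).
      - by apply: emeasurable_funD => //; exact: measurable_funeM.
      - move=> y _; rewrite -EFinM -EFinD lee_fin /deficit ge_max; apply/andP; split; last first.
          by rewrite addr_ge0// mulr_ge0.
        rewrite lerNl; set X := fun w => _.
        apply: le_trans (rmax_ge v0 (overlap X) (finset.in_setT v)).
        rewrite /overlap le_min.
        have -> : X (v, true) = a * M x + b' * eta v y by rewrite /M E.
        have -> : X (v, false) = b' * M x + (- a) * eta v y by rewrite /M E.
        have /andP[p1 _] := scaled a (M x - g) a_ge0 a1.
        have /andP[p2 _] := scaled b' (M x - g) b'_ge0 b'1.
        have /andP[p3 _] := scaled b' (eta v y) b'_ge0 b'1.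
        have /andP[_ p4] := scaled a (eta v y) a_ge0 a1.
        have := normr_ge0 (M x - g); have := normr_ge0 (eta v y).
        by move=> q1 q2; apply/andP; split; lra.
    rewrite ge0_integralD//; last exact: measurable_funeM.
    rewrite integral_cst// [X in (_ * X + \int[_]_x _ <= _)%E]probability_setT mule1.
    rewrite -EFinM leeD2l// ge0_integralZl_EFin// EFinM lee_wpmul2l ?lee_fin//.
    exact: (gaussian_field_abs_le gauss_eta sigma_gt0 var_le).
rewrite ge0_integralD//; last 2 first.
- exact: measurable_funeM.
- by move=> x _; rewrite lee_fin mulr_ge0// ltW.
rewrite integral_cst// [X in (_ + _ * X)%E]probability_setT mule1.
rewrite ge0_integralZl_EFin//.
apply: (@le_trans _ _ (2%:E * (C * sigma)%:E + (2 * sigma)%:E)%E).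
  by rewrite leeD2r// lee_wpmul2l ?lee_fin// (gfun_deviation (finset.in_setT v0)).
have -> : (2 * C + 2) * sigma = 2 * (C * sigma) + 2 * sigma by ring.
by rewrite EFinD (EFinM 2) lexx.
Qed.

(* The pair [(eta, eta')] is replaced by its rotation
   [(a eta + b' eta', b' eta - a eta')]; the maximizer of [eta] then makes both
   coordinates nearly [a g] and [b' g]. *)
Lemma level_set_lower_tail :
  ((c1 * g - C * sigma)%:E * P [set w | (gfun P eta (U w) <= ((b - eps) * g)%:E)%E]
    <= ((2 * C + 2) * sigma)%:E)%E.
Proof.
have mdef := bifield_measurable gauss_eta 1 0 0 1 latfun_deficit.
have mB := level_set_measurable alpha [set S | (gfun P eta S <= ((b - eps) * g)%:E)%E].
apply: le_trans rotated_deficit.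
have r1 : 1 ^+ 2 + 0 ^+ 2 = a ^+ 2 + b' ^+ 2 by rewrite ab'; ring.
have r2 : 1 * 0 + 0 * 1 = a * b' + b' * - a by ring.
have r3 : 0 ^+ 2 + 1 ^+ 2 = b' ^+ 2 + (- a) ^+ 2 by rewrite sqrrN addrC r1 addrC.
rewrite -(bifield_rotation gauss_eta sigma_gt0 var_le k2_gt0 k2_lty r1 r2 r3 latfun_deficit).
apply: (section_markov mdef (fun z => deficit_ge0 _) mB); first by rewrite subr_ge0.
exact: section_deficit.
Qed.

End lower.

End level_set_tails.

(** * Convergence in probability *)

(* A positive [field_sigma] excludes the junk value [fine +oo = 0], so it also
   certifies that the second moments are finite. *)
Lemma field_sigma_gt0 {R : realType} d (T : measurableType d)
    (P : probability T R) (V : finType) (eta : V -> T -> R) :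
  centered_gaussian_field P eta -> 0 < field_sigma P eta ->
  [/\ forall v, (\int[P]_w (eta v w ^+ 2)%:E <= (field_sigma P eta ^+ 2)%:E)%E,
      (0 < gaussint 1 (fun x : R => (x ^+ 2)%:E))%E &
      (gaussint 1 (fun x : R => (x ^+ 2)%:E) < +oo)%E].
Proof.
move=> gauss; rewrite /field_sigma.
have EE v : ('E_P[fun w => (eta v w ^+ 2)%R] = \int[P]_w (eta v w ^+ 2)%:E)%E.
  by rewrite unlock.
under eq_bigr do rewrite EE.
set M := \big[_/_]_v _; rewrite sqrtr_gt0 => M0.
have Mfin : M \is a fin_num by move: M0; case: M => //=; rewrite ltxx.
have ME : ((Num.sqrt (fine M) ^+ 2)%:E = M)%E by rewrite sqr_sqrtr ?(ltW M0)// fineK.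
have /bigmax_geP[|[v _ Mv]] := lexx M.
  by rewrite leeNy_eq => /eqP MNy; rewrite MNy in Mfin.
have leM u : (\int[P]_w (eta u w ^+ 2)%:E <= M)%E.
  exact: (le_bigmax_cond _ (fun u => (\int[P]_w (eta u w ^+ 2)%:E)%E)).
have vM : (\int[P]_w (eta v w ^+ 2)%:E = M)%E by apply/eqP; rewrite eq_le leM.
have gv : centered_gaussian_rv P (eta v).
  have := gauss (fun u => if u == v then 1 else 0).
  congr centered_gaussian_rv; apply/funext => w.
  rewrite (bigD1 v)//= eqxx mul1r big1 ?addr0// => u /negbTE ->.
  by rewrite mul0r.
(* The second moment at the maximizing [v] is [M], positive and finite, and also [s^2 * k]; this
   forces [k] to be positive and finite. *)
have [s s0 law] := centered_gaussian_rv_integral gv.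
have := law (fun x => (x ^+ 2)%:E).
rewrite (gaussint_sqr s0) vM; set k := gaussint _ _ => Mk.
have {}Mk : (M = (s ^+ 2)%:E * k)%E.
  apply: Mk => [|x]; last by rewrite lee_fin sqr_ge0.
  by apply/measurable_EFinP; exact: measurable_funX.
have k0 : (0 <= k)%E by apply: gaussint_ge0 => x; rewrite lee_fin sqr_ge0.
have M0' : (0 < M)%E by rewrite -(fineK Mfin) lte_fin.
have sn0 : s != 0.
  by apply/eqP => s00; move: M0'; rewrite Mk s00 expr0n mul0e ltxx.
have s20 : 0 < s ^+ 2 by rewrite exprn_even_gt0.
split.
- by move=> u; rewrite ME; exact: leM.
- rewrite lt_neqAle k0 andbT eq_sym; apply/eqP => k00.
  by move: M0'; rewrite Mk k00 mule0 ltxx.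
- rewrite ltey; apply/eqP => ky.
  by move: Mfin; rewrite Mk ky gt0_muley// lte_fin.
Qed.

Lemma rotation_angle {R : realType} (alpha eps : R) : 0 < alpha < 1 -> 0 < eps ->
  exists a b' c1 : R, [/\ a ^+ 2 + b' ^+ 2 = 1, 0 <= a /\ 0 <= b', 0 < c1,
    c1 <= a - alpha & c1 <= b' - Num.sqrt (1 - alpha ^+ 2) + eps].
Proof.
move=> /andP[a0 a1] e0.
have a20 : 0 < 1 - alpha ^+ 2 by nra.
(* The amount by which [a^2] exceeds [alpha^2]: the first bound keeps the loss from [b] to [b']
   below [eps / 2], the second keeps [b'] real. *)
pose m := Num.min (eps ^+ 2 / 4) (1 - alpha ^+ 2).
have m0 : 0 < m by rewrite lt_min a20 andbT divr_gt0// exprn_gt0.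
have m1 : m <= eps ^+ 2 / 4 by rewrite ge_min lexx.
have m2 : m <= 1 - alpha ^+ 2 by rewrite ge_min lexx orbT.
have am0 : 0 <= alpha ^+ 2 + m by rewrite addr_ge0 ?sqr_ge0// ltW.
have bm0 : 0 <= 1 - alpha ^+ 2 - m by rewrite subr_ge0.
pose a := Num.sqrt (alpha ^+ 2 + m); pose b' := Num.sqrt (1 - alpha ^+ 2 - m).
have aE : a ^+ 2 = alpha ^+ 2 + m by rewrite sqr_sqrtr.
have bE : b' ^+ 2 = 1 - alpha ^+ 2 - m by rewrite sqr_sqrtr.
have a_ge0 : 0 <= a by exact: sqrtr_ge0.
have b_ge0 : 0 <= b' by exact: sqrtr_ge0.
have aa : alpha < a by rewrite -(@ltr_pXn2r _ 2) ?nnegrE// ?(ltW a0)// aE ltrDl.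
exists a, b', (Num.min (a - alpha) (eps / 2)); split.
- by rewrite aE bE; ring.
- by [].
- by rewrite lt_min subr_gt0 aa divr_gt0.
- by rewrite ge_min lexx.
- rewrite ge_min; apply/orP; right.
  suff : Num.sqrt (1 - alpha ^+ 2) <= b' + eps / 2 by lra.
  rewrite -[leRHS]ger0_norm; last by rewrite addr_ge0// divr_ge0// ltW.
  rewrite -sqrtr_sqr ler_wsqrtr//.
  have : 0 <= b' * eps by rewrite mulr_ge0// ltW.
  have -> : (b' + eps / 2) ^+ 2 = b' ^+ 2 + b' * eps + eps ^+ 2 / 4 by field.
  rewrite bE; lra.
Qed.

(** [A] and [rho] are chosen before the field, hence serve the whole sequence; convergence then
    reduces to [A / r] tending to 0. *)
Lemma level_set_deviation {R : realType} (alpha eps : R) :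
  0 < alpha < 1 -> 0 < eps -> exists A rho : R,
  forall d (T : measurableType d) (P : probability T R) (V : finType)
    (eta : V -> T -> R), (0 < #|V|)%N -> centered_gaussian_field P eta ->
    let r := fine (gfun P eta [set: V]) / field_sigma P eta in
    0 < r -> rho <= r ->
    (P [set w | (eps%:E <=
        `| gfun P eta (level_set P eta alpha w)
             * ((fine (gfun P eta [set: V]))^-1)%:E
           - (Num.sqrt (1 - alpha ^+ 2))%:E |)%E] <= (A / r)%:E)%E.
Proof.
move=> alpha01 e0; have [a [b' [c1 [ab' [a_ge0 b'_ge0] c10 c1_a c1_b]]]] :=
  rotation_angle alpha01 e0.
pose C : R := pi + 1; pose b := Num.sqrt (1 - alpha ^+ 2).
have b0 : 0 < b by rewrite sqrtr_gt0; move: alpha01 => /andP[? ?]; nra.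
have C0 : 0 < C by rewrite addr_gt0// pi_gt0.
(* The two terms of [A] come from the upper and lower tails; [rho] ensures [C * s <= c1 * g / 2], so
   [c1 * g - C * s] is at least [c1 * g / 2]. *)
exists (C / (b * eps) + 2 * (2 * C + 2) / c1), (2 * C / c1).
move=> d T P V eta /card_gt0P[v0 _] gauss; set g := fine _; set s := field_sigma P eta.
move=> r r0 rho.
(* Division by zero yields 0, so [0 < r] excludes [s = 0]. *)
have s0 : 0 < s.
  rewrite lt_neqAle sqrtr_ge0 andbT eq_sym; apply/eqP => s00.
  by move: r0; rewrite /r s00 invr0 mulr0 ltxx.
have g0 : 0 < g by move: r0; rewrite /r pmulr_lgt0// invr_gt0.
have [var_le k2_gt0 k2_lty] := field_sigma_gt0 gauss s0.
set U := level_set P eta alpha; set Bad := [set w | _].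
pose B1 := [set w | (((b + eps) * g)%:E <= gfun P eta (U w))%E].
pose B2 := [set w | (gfun P eta (U w) <= ((b - eps) * g)%:E)%E].
have mQ Q : measurable [set w | Q (U w)] by exact: level_set_measurable.
have mB1 : measurable B1 := mQ [set S | (((b + eps) * g)%:E <= gfun P eta S)%E].
have mB2 : measurable B2 := mQ [set S | (gfun P eta S <= ((b - eps) * g)%:E)%E].
have mBad : measurable Bad := mQ [set S | (eps%:E <=
   `| gfun P eta S * (g^-1)%:E - b%:E |)%E].
have sub : Bad `<=` B1 `|` B2.
  move=> w; rewrite /Bad/= /B1 /B2/=.
  (* An empty level set has [gfun] equal to -oo and counts as a lower deviation. *)
  have [U0|[v1 v1U]] := set_0Vmem (U w).
    by right; rewrite U0 /gfun eqxx leNye.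
  have := gfun_fin_num gauss s0 var_le v1U.
  case: (gfun P eta (U w)) => // u _.
  rewrite -/b -EFinM -EFinB !lee_fin lter_normr => /orP[h|h]; [left|right].
    by rewrite -ler_pdivlMr//; lra.
  by rewrite -ler_pdivrMr//; lra.
have CS : 2 * C * s <= c1 * g.
  by move: rho; rewrite /r ler_pdivrMr// mulrAC ler_pdivlMr// [g * c1]mulrC.
have f1 : P B1 \is a fin_num by exact: fin_num_measure.
have f2 : P B2 \is a fin_num by exact: fin_num_measure.
have P1 : fine (P B1) <= C / (b * eps) / r.
  have := level_set_upper_tail gauss s0 var_le k2_gt0 k2_lty v0 g0 alpha01 e0.
  rewrite -/U -/B1 -/g -/b -/C -(fineK f1) -EFinM lee_fin => h.
  have -> : C / (b * eps) / r = C * s / (b * eps * g).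
    by rewrite /r; field; rewrite !gt_eqF.
  by rewrite ler_pdivlMr ?mulr_gt0// mulrC.
have P2 : fine (P B2) <= 2 * (2 * C + 2) / c1 / r.
  have CS1 : C * s <= c1 * g by have := mulr_gt0 C0 s0; lra.
  have := level_set_lower_tail gauss s0 var_le k2_gt0 k2_lty v0 g0 ab' a_ge0 b'_ge0
    c1_a c1_b CS1.
  rewrite -/U -/B2 -/g -/b -/C -(fineK f2) -EFinM lee_fin => h.
  have p0 : 0 <= fine (P B2) by rewrite fine_ge0.
  have : (c1 * g / 2) * fine (P B2) <= (c1 * g - C * s) * fine (P B2).
    by rewrite ler_wpM2r//; lra.
  have -> : 2 * (2 * C + 2) / c1 / r = (2 * C + 2) * s / (c1 * g / 2).
    by rewrite /r; field; rewrite !gt_eqF.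
  move=> /le_trans /(_ h) {}h.
  by rewrite ler_pdivlMr ?divr_gt0 ?mulr_gt0// mulrC.
apply: (@le_trans _ _ (P (B1 `|` B2))).
  by apply: le_measure; rewrite ?inE//; exact: measurableU.
apply: (@le_trans _ _ ((fine (P B1))%:E + (fine (P B2))%:E)%E).
  by rewrite !fineK//; exact: measureU2.
rewrite -EFinD lee_fin mulrDl.
exact: lerD.
Qed.

Theorem theorem1p1 (R : realType) (V : nat -> finType)
  (d : nat -> measure_display) (T : forall n, measurableType (d n))
  (P : forall n, probability (T n) R) (eta : forall n, V n -> T n -> R)
  (alpha : R) :
  (forall n, 0 < #|V n|)%N ->
  (forall n, centered_gaussian_field (P n) (eta n)) ->
  (fun n => fine (gfun (P n) (eta n) [set: V n]) / field_sigma (P n) (eta n))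
    @ \oo --> +oo ->
  0 < alpha < 1 ->
  forall eps : R, 0 < eps ->
    (fun n => P n [set w | (eps%:E <=
        `| gfun (P n) (eta n) (level_set (P n) (eta n) alpha w)
             * ((fine (gfun (P n) (eta n) [set: V n]))^-1)%:E
           - (Num.sqrt (1 - alpha ^+ 2))%:E |)%E])
    @ \oo --> 0%E.
Proof.
move=> V0 gauss ratio alpha01 eps e0.
have [A [rho dev]] := level_set_deviation alpha01 e0.
pose r n := fine (gfun (P n) (eta n) [set: V n]) / field_sigma (P n) (eta n).
have r_ge M : \forall n \near \oo, M <= r n by exact: (cvgryPge _).1.
apply: (@squeeze_cvge _ _ _ _ (cst 0%E) _ (fun n => (A / r n)%:E)).
- near=> n; rewrite measure_ge0/=.
  by apply: dev => //; [rewrite (@lt_le_trans _ _ 1)//; near: n|near: n]; exact: r_ge.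
- exact: cvg_cst.
- apply: cvg_EFin; first exact: nearW.
  apply/cvgrPdist_le => e epos; near=> n.
  have rn0 : 0 < r n by rewrite (@lt_le_trans _ _ 1)//; near: n; exact: r_ge.
  rewrite sub0r normrN /= normrM normfV (gtr0_norm rn0) ler_pdivrMr// mulrC.
  by rewrite -ler_pdivrMr//; near: n; exact: r_ge.
Unshelve. all: by end_near. Qed.
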